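(* Let $f:\mathbb{D}^n\to\mathbb{D}$ be holomorphic and $\mathcal{C}^1$-smooth on the closed polydisc $\overline{\mathbb{D}}^n$. Suppose that $f(\zeta)=\eta$ for some $\zeta\in\mathbb{T}^n$ and $\eta\in\mathbb{T}$. Suppose also that for every $j=1,\ldots,n$ the function $z_j\mapsto f(\zeta_1,\ldots,\zeta_{j-1},z_j,\zeta_{j+1},\ldots,\zeta_n)$ is not constant. Then there are a (sufficiently small) neighbourhood $U$ of $\zeta$ and a constant $C>0$ such that for all $\delta>0$ $$\operatorname{vol}(\{z\in\mathbb{D}^n\cap U:\ |f(z)-\eta|\le\delta\})\le C\,\delta^{n+1}.$$
   Context: $\mathbb{D}$ is the open unit disc in $\mathbb{C}$, $\mathbb{T}=\partial\mathbb{D}$, and $\operatorname{vol}$ is ($2n$-dimensional, normalized) Lebesgue volume on $\mathbb{D}^n$. ''$\mathcal{C}^1$-smooth on the closed polydisc'' means that $f$ extends to a $\mathcal{C}^1$ function on $\overline{\mathbb{D}}^n$; values of $f$ at boundary points are those of the extension. *)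

(* Defs.v *)
From HB Require Import structures.
From mathcomp Require Import all_boot all_order all_algebra.
From mathcomp Require Import complex.
From mathcomp Require Import all_classical all_reals all_analysis.

Set Implicit Arguments.
Unset Strict Implicit.
Unset Printing Implicit Defensive.

Import Order.TTheory GRing.Theory Num.Theory.
Import numFieldNormedType.Exports.

Local Open Scope classical_set_scope.
Local Open Scope complex_scope.
Local Open Scope ring_scope.

(* R[i] as a one-dimensional normed space over itself. Consequently
   ['rV[R[i]]_n] is a normed space over R[i] and [differentiable] on it means
   complex (Frechet) differentiability. *)
HB.instance Definition _ (R : rcfType) := NormedModule.copy R[i] R[i]^o.

Section Polydisc.
Context {R : realType} (n : nat).

Definition polydisc : set 'rV[R[i]]_n := [set z | forall j, `|z 0 j| < 1].

Definition closed_polydisc : set 'rV[R[i]]_n :=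
  [set z | forall j, `|z 0 j| <= 1].

Definition torus : set 'rV[R[i]]_n := [set z | forall j, `|z 0 j| = 1].

Definition holomorphic_on (D : set 'rV[R[i]]_n) (f : 'rV[R[i]]_n -> R[i]) :=
  forall z, D z -> differentiable f z.

(* The increment [h] is real: for [v = e_j] and [v = 'i *: e_j] this is the
   partial derivative along x_j and y_j respectively, where z_j = x_j + i y_j. *)
Definition is_real_derive (f : 'rV[R[i]]_n -> R[i]) (z v : 'rV[R[i]]_n)
    (l : R[i]) :=
  (fun h : R => (h^-1)%:C * (f (z + h%:C *: v) - f z)) @ 0^' --> l.

(* [f] is continuous on the closed polydisc, and its 2n first-order real partial
   derivatives exist on the open polydisc and extend continuously to the closed
   one. The values of [f] outside the closed polydisc are irrelevant. *)
Definition C1_closed_polydisc (f : 'rV[R[i]]_n -> R[i]) :=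
  {within closed_polydisc, continuous f} /\
  forall (j : 'I_n) (u : R[i]), u = 1 \/ u = 'i%C ->
    exists g : 'rV[R[i]]_n -> R[i],
      {within closed_polydisc, continuous g} /\
      forall z, polydisc z -> is_real_derive f z (u *: delta_mx 0 j) (g z).

Definition subst_coord (z : 'rV[R[i]]_n) (j : 'I_n) (w : R[i]) : 'rV[R[i]]_n :=
  \row_k (if k == j then w else z 0 k).

End Polydisc.

Section Volume.
Local Open Scope ereal_scope.
Context {R : realType}.

Fixpoint power_measure d (T : measurableType d) (mu : set T -> \bar R)
    (n : nat) : set (n.-tuple T) -> \bar R :=
  match n with
  | 0 => \d_ [tuple]
  | m.+1 => pushforward (mu \x @power_measure _ _ mu m)
              (fun p => [tuple of p.1 :: p.2])
  end.

(* R^2 with its Borel sigma-algebra. *)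
Local Notation plane := (measurableTypeR R * measurableTypeR R)%type.

Definition lebesgue_plane : set plane -> \bar R :=
  lebesgue_measure \x lebesgue_measure.

(* 2n-dimensional Lebesgue measure on C^n, through z_j = x_j + i y_j; dividing by
   pi ^ n gives the unit polydisc volume 1. *)
Definition vol n (A : set 'rV[R[i]]_n) : \bar R :=
  ((pi ^+ n)^-1)%:E *
  power_measure lebesgue_plane
    [set t : n.-tuple plane |
       A (\row_j ((tnth t j).1 +i* (tnth t j).2)%C)].

End Volume.

(* Main.v *)
Require Import Defs.
From mathcomp Require Import all_boot all_order all_algebra.
From mathcomp Require Import complex.
From mathcomp Require Import all_classical all_reals all_analysis.
From mathcomp Require Import measurable_realfun ring lra.
Import Order.TTheory GRing.Theory Num.Theory.
Import numFieldNormedType.Exports.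
Local Open Scope classical_set_scope.
Local Open Scope complex_scope.
Local Open Scope ring_scope.

(* Along each coordinate through [zeta], [f] is a nonconstant holomorphic self-map
   of the disc, [C^1] up to the boundary, so by Hopf's lemma its derivative at
   [zeta_j] satisfies [Re (conj eta * d_j f * zeta_j) > 0]. Hence near [zeta]
   (1) moving [z_j] outwards to the circle increases [Re (conj eta * f)], which
   stays below 1, so [1 - |z_j| <= c |f z - eta|] for every [j];
   (2) [f] is bi-Lipschitz in each variable, as its derivative does not vanish.
   If [|f - eta| <= delta], then by (1) each [z_j] lies in an annulus of area
   O(delta), and by (2) the last one lies, once the others are fixed, in a square
   of side O(delta): the volume is O(delta^(n-1) * delta^2).

   The mean value property behind Hopf's lemma is obtained without integration,
   by averaging over roots of unity. *)

(** For n >= 2 the slices through [zeta] lie in the boundary of the polydisc, where holomorphy of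
    [f] is not given: neither a complex derivative of a slice nor one at [zeta] is available
    directly. Both come from one estimate, strict differentiability in each variable uniformly in
    the base point, proved by shrinking into the open polydisc, using a mean value inequality there,
    and letting the shrinking factor tend to 1. The maximum principle then has to work from strict
    differentiability on closed discs alone. Hopf's lemma takes a multiplicative form, |g|^N <= |w|
    near the circle. It gives 1 - |g| >= (1 - |w|) / N, a linear rate, with powers of [g] in place
    of a harmonic barrier. The sublevel set is never shown to be measurable; its iterated integral
    is bounded through measurable sets that contain its slices. *)

Import ComplexField.Normc.

(** * The modulus as a real number, and compactness of annuli *)

Section Modulus.
Context {R : realType}.
Implicit Types (x y z : R[i]) (t : R).

Lemma normc_ge0 z : 0 <= normc z.
Proof. by case: z => a b; exact: sqrtr_ge0. Qed.

Lemma normc_real t : normc t%:C = `|t|.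
Proof. by rewrite /normc /= expr0n addr0 sqrtr_sqr. Qed.

Lemma normcD x y : normc (x + y) <= normc x + normc y.
Proof. exact: le_normcD. Qed.

Lemma normcN x : normc (- x) = normc x.
Proof. by case: x => a b /=; rewrite !sqrrN. Qed.

Lemma normc_distC x y : normc (x - y) = normc (y - x).
Proof. by rewrite -normcN opprB. Qed.

Lemma normcB x y : normc (x - y) <= normc x + normc y.
Proof. by rewrite -[normc y]normcN normcD. Qed.

Lemma ler_normc_dist x y : normc x - normc y <= normc (x - y).
Proof. by rewrite lerBlDr (le_trans _ (normcD _ _))// subrK. Qed.

Lemma normc_dist_trans x y z : normc (x - z) <= normc (x - y) + normc (y - z).
Proof. by rewrite (le_trans _ (normcD _ _))// addrA subrK. Qed.

Lemma normc_eq0 z : (normc z == 0) = (z == 0).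
Proof.
by apply/eqP/eqP => [/eq0_normc//|->]; rewrite normc0.
Qed.

Lemma normc_gt0 z : (0 < normc z) = (z != 0).
Proof. by rewrite lt_neqAle normc_ge0 andbT eq_sym normc_eq0. Qed.

Lemma normcX z n : normc (z ^+ n) = normc z ^+ n.
Proof. by elim: n => [|n ih]; rewrite ?expr0 ?normc1// !exprS normcM ih. Qed.

Lemma normc_sum (I : Type) (r : seq I) (P : pred I) (F : I -> R[i]) :
  normc (\sum_(i <- r | P i) F i) <= \sum_(i <- r | P i) normc (F i).
Proof.
elim/big_ind2 : _ => [|x1 x2 y1 y2 h1 h2|//]; first by rewrite normc0.
by rewrite (le_trans (normcD _ _))// lerD.
Qed.

Lemma Re_le_normc z : complex.Re z <= normc z.
Proof.
case: z => a b /=; rewrite (le_trans (ler_norm a))// -sqrtr_sqr ler_wsqrtr//.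
by rewrite lerDl sqr_ge0.
Qed.

Lemma sqr_normc2 z : normc z ^+ 2 = complex.Re z ^+ 2 + complex.Im z ^+ 2.
Proof. by case: z => a b /=; rewrite sqr_sqrtr// addr_ge0 ?sqr_ge0. Qed.

Lemma normr_Re_le z : `|complex.Re z| <= normc z.
Proof.
rewrite -(@ler_pXn2r _ 2) ?nnegrE ?normc_ge0// sqr_normc2.
by rewrite real_normK ?num_real// lerDl sqr_ge0.
Qed.

Lemma normr_Im_le z : `|complex.Im z| <= normc z.
Proof.
rewrite -(@ler_pXn2r _ 2) ?nnegrE ?normc_ge0// sqr_normc2.
by rewrite real_normK ?num_real// lerDr sqr_ge0.
Qed.

Lemma normc_conj z : normc z^* = normc z.
Proof. by case: z => a b /=; rewrite sqrrN. Qed.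

Lemma normc_le_coord (a b : R) : normc (a +i* b) <= `|a| + `|b|.
Proof.
rewrite /= -[leRHS]ger0_norm ?addr_ge0// -sqrtr_sqr ler_wsqrtr//.
rewrite sqrrD !real_normK ?num_real// lerD2r lerDl mulrn_wge0//.
Qed.

End Modulus.

(** Compactness of the square of side 2b around the annulus: off the annulus the property is
    vacuous, and the complement is open, so only the local hypothesis has to be supplied. Taking a =
    0 gives closed discs. All later compactness arguments go through this form, with [d] read as a
    radius, a gap or the inverse of a bound. *)
Lemma annulus_uniform {R : realType} (a b : R) (P : R -> R[i] -> Prop) :
  (forall p, a <= normc p <= b -> exists2 rho, 0 < rho &
     forall d q, 0 < d < rho -> a <= normc q <= b -> normc (q - p) < rho ->
       P d q) ->
  exists2 d, 0 < d & forall q, a <= normc q <= b -> P d q.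
Proof.
move=> Ploc.
have cK : compact (`[- b, b] `*` `[- b, b] : set (R * R)).
  by apply: compact_setX; exact: segment_compact.
pose Q (d : R) (u : R * R) :=
  a <= normc (u.1 +i* u.2) <= b -> P d (u.1 +i* u.2).
have H : \forall d \near 0^'+, `[- b, b] `*` `[- b, b] `<=` Q d.
  apply: (iffLR (compact_near_coveringP _) cK) => -[x y] _.
  set p := x +i* y.
  have [rho rho0 H] : exists2 rho, 0 < rho & forall d q, 0 < d < rho ->
      normc (q - p) < rho -> a <= normc q <= b -> P d q.
    have [/Ploc[rho rho0 H]|Np] := boolP (a <= normc p <= b).
      by exists rho => // d q ? ? ?; exact: H.
    have [|ap] := ltP (normc p) a => [pa|].
      exists (a - normc p); first by rewrite subr_gt0.
      move=> d q _ qp /andP[aq _]; exfalso.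
      have := ler_normc_dist q p; lra.
    have bp : b < normc p by rewrite ltNge; apply: contra Np => ->; rewrite ap.
    exists (normc p - b); first by rewrite subr_gt0.
    move=> d q _ qp /andP[_ qb]; exfalso.
    have := ler_normc_dist p q; rewrite normc_distC; lra.
  exists ([set u : R * R | `|x - u.1| < rho / 2 /\ `|y - u.2| < rho / 2],
          [set d : R | 0 < d < rho]) => /=.
    split; last by near=> d; apply/andP; split.
    exists (ball x (rho / 2), ball y (rho / 2)) => /=.
      by split; apply: nbhsx_ballx; rewrite divr_gt0.
    by move=> [u v] /=.
  move=> [[u v] d] /= [[ux vy] d0]; apply: H => //.
  rewrite (le_lt_trans (normc_le_coord _ _))//.
  by rewrite /= (distrC u) (distrC v) [ltRHS]splitr ltrD.
have [d [Qd d0]] : exists d, `[- b, b] `*` `[- b, b] `<=` Q d /\ 0 < d.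
  by apply: (@filter_ex _ (0 : R)^'+); apply: filterI H (nbhs_right_gt _).
exists d => // -[u v] quv.
have le_coord (w : R) : `|w| <= normc (u +i* v) -> w \in `[- b, b].
  by case/andP: quv => _ qb h; rewrite in_itv /= -ler_norml (le_trans h).
apply: (Qd (u, v)) => //; split; apply: le_coord.
  by rewrite /= -sqrtr_sqr ler_wsqrtr// lerDl sqr_ge0.
by rewrite /= -sqrtr_sqr ler_wsqrtr// lerDr sqr_ge0.
Unshelve. all: by end_near. Qed.

(** * Strict differentiability and the mean value property *)

(* Strict differentiability at [p] relative to [D]: unlike differentiability on
   the interior plus continuity of the derivative, it makes sense at boundary
   points and is stable under restriction of [D]. *)
Definition strict_diff {R : realType} (D : set R[i]) (g : R[i] -> R[i])
    (p : R[i]) :=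
  exists A : R[i], forall eps : R, 0 < eps -> exists2 rho : R, 0 < rho &
    forall w w', D w -> D w' -> normc (w - p) < rho -> normc (w' - p) < rho ->
      normc (g w' - g w - A * (w' - w)) <= eps * normc (w' - w).

Section StrictDiff.
Context {R : realType}.
Implicit Types (D E : set R[i]) (g h : R[i] -> R[i]) (p : R[i]).

Lemma strict_diffS D E g p : D `<=` E -> strict_diff E g p -> strict_diff D g p.
Proof.
move=> DE [A gA]; exists A => eps /gA[rho rho0 H]; exists rho => // w w' ? ?.
by apply: H; exact: DE.
Qed.

Lemma strict_diff_cst D (c : R[i]) p : strict_diff D (fun=> c) p.
Proof.
exists 0 => eps eps0; exists 1 => // w w' _ _ _ _.
by rewrite mul0r !subrr normc0 mulr_ge0 ?normc_ge0// ltW.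
Qed.

Lemma strict_diff_cont D g p : D p -> strict_diff D g p ->
  forall eps : R, 0 < eps -> exists2 rho : R, 0 < rho &
    forall w, D w -> normc (w - p) < rho -> normc (g w - g p) <= eps.
Proof.
move=> Dp [A gA] eps eps0.
have [rho rho0 H] := gA 1 ltr01.
have K0 : 0 < normc A + 1 by rewrite ltr_wpDl// normc_ge0.
exists (Num.min rho (eps / (normc A + 1))).
  by rewrite lt_min rho0 divr_gt0.
move=> w Dw; rewrite lt_min => /andP[wrho weps].
have := H p w Dp Dw; rewrite subrr normc0 => /(_ rho0 wrho) Hw.
rewrite -[g w - g p](subrK (A * (w - p))) (le_trans (normcD _ _))//.
rewrite (le_trans (lerD Hw (lexx _)))// normcM -mulrDl.
by rewrite addrC mulrC -ler_pdivlMr// ltW.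
Qed.

Lemma strict_diffM D g h p : D p -> strict_diff D g p -> strict_diff D h p ->
  strict_diff D (fun w => g w * h w) p.
Proof.
move=> Dp dg dh; have cg := strict_diff_cont _ _ _ Dp dg.
have ch := strict_diff_cont _ _ _ Dp dh.
case: dg dh => [A gA] [B hB]; exists (A * h p + g p * B) => eps eps0.
(* [K] collects the coefficients of [e * normc (w' - w)] in the four-term splitting below; its 2
   comes from [e <= 1], which bounds [h w'] and [g w] by their moduli at [p] plus 1. *)
set K := normc (g p) + normc (h p) + normc A + normc B + 2.
have K0 : 0 < K by rewrite ltr_wpDl// !addr_ge0// normc_ge0.
set e := Num.min 1 (eps / K).
have e0 : 0 < e by rewrite lt_min ltr01 divr_gt0.
have e1 : e <= 1 by rewrite ge_min lexx.
have eK : e * K <= eps by rewrite -ler_pdivlMr// ge_min lexx orbT.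
have [r1 r10 H1] := cg _ e0; have [r2 r20 H2] := ch _ e0.
have [r3 r30 H3] := gA _ e0; have [r4 r40 H4] := hB _ e0.
exists (Num.min (Num.min r1 r2) (Num.min r3 r4)).
  by rewrite !lt_min r10 r20 r30.
move=> w w' Dw Dw'.
rewrite !lt_min => /andP[/andP[w1 w2] /andP[w3 w4]].
move=> /andP[/andP[w1' w2'] /andP[w3' w4']].
have -> : g w' * h w' - g w * h w - (A * h p + g p * B) * (w' - w) =
    (g w' - g w - A * (w' - w)) * h w' + A * (w' - w) * (h w' - h p) +
    g w * (h w' - h w - B * (w' - w)) + (g w - g p) * (B * (w' - w)).
  by ring.
have := H1 w Dw w1; have := H2 w' Dw' w2'.
have := H3 w w' Dw Dw' w3 w3'; have := H4 w w' Dw Dw' w4 w4'.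
set d := normc (w' - w); have d0 : 0 <= d := normc_ge0 _.
move=> h4 h3 h2 h1.
have bh : normc (h w') <= normc (h p) + 1.
  by rewrite -lerBlDl (le_trans (ler_normc_dist _ _))// (le_trans h2).
have bg : normc (g w) <= normc (g p) + 1.
  by rewrite -lerBlDl (le_trans (ler_normc_dist _ _))// (le_trans h1).
have sum4 (x y z t : R[i]) :
    normc (x + y + z + t) <= normc x + normc y + normc z + normc t.
  rewrite (le_trans (normcD _ _))// lerD2r (le_trans (normcD _ _))// lerD2r.
  exact: normcD.
rewrite (le_trans (sum4 _ _ _ _))// !normcM -/d.
apply: (@le_trans _ _ ((e * d) * (normc (h p) + 1) + normc A * d * e +
   (normc (g p) + 1) * (e * d) + e * (normc B * d))).
  rewrite !lerD ?ler_pM ?normc_ge0 ?mulr_ge0 ?normc_ge0//.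
rewrite (_ : _ + _ = e * K * d); last by rewrite /K; ring.
by rewrite ler_wpM2r.
Qed.

Lemma strict_diffX D g p n : D p -> strict_diff D g p ->
  strict_diff D (fun w => g w ^+ n) p.
Proof.
move=> Dp dg; elim: n => [|n ih].
  rewrite (_ : (fun _ => _) = fun=> 1); first exact: strict_diff_cst.
  by apply/funext => w; rewrite expr0.
rewrite (_ : (fun _ => _) = fun w => g w * g w ^+ n); first exact: strict_diffM.
by apply/funext => w; rewrite exprS.
Qed.

Lemma strict_diffV D p : p != 0 -> strict_diff D (fun w => w^-1) p.
Proof.
move=> p0; exists (- (p ^+ 2)^-1) => eps eps0.
set a := normc p; have a0 : 0 < a by rewrite normc_gt0.
(* Within a/2 of [p] the moduli lie between a/2 and 3a/2. For a radius r the error factor is then at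
   most (3a/2 + a) r / (a^2 (a/2)^2) = 10 r / a^3. *)
exists (Num.min (a / 2) (eps * a ^+ 3 / 10)).
  by rewrite lt_min !divr_gt0// mulr_gt0// exprn_gt0.
move=> w w' _ _; rewrite !lt_min => /andP[w1 w2] /andP[w1' w2'].
have big x : normc (x - p) < a / 2 -> a / 2 <= normc x.
  by move=> xp; have := ler_normc_dist p x; rewrite normc_distC -/a; lra.
have bw := big _ w1; have bw' := big _ w1'.
have w0 : w != 0 by rewrite -normc_gt0; lra.
have w0' : w' != 0 by rewrite -normc_gt0; lra.
have -> : w'^-1 - w^-1 - - (p ^+ 2)^-1 * (w' - w) =
    (w' * (w - p) + p * (w' - p)) * (p ^- 2 * w^-1 * w'^-1) * (w' - w).
  by field; rewrite w0 w0' p0.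
rewrite normcM ler_wpM2r ?normc_ge0// 3!normcM !normcV normcX -/a.
rewrite -!invfM ler_pdivrMr; last first.
  by rewrite !mulr_gt0 ?exprn_gt0 ?normc_gt0.
have upw' : normc w' <= a * (3 / 2).
  by have := ler_normc_dist w' p; rewrite -/a; lra.
apply: (@le_trans _ _ (a * (3 / 2) * (eps * a ^+ 3 / 10) + a * (eps * a ^+ 3 / 10))).
  rewrite (le_trans (normcD _ _))// !normcM -/a.
  by rewrite lerD// ler_pM ?normc_ge0// ltW.
have -> : a * (3 / 2) * (eps * a ^+ 3 / 10) + a * (eps * a ^+ 3 / 10) =
  eps * (a ^+ 2 * (a / 2) * (a / 2)) by field.
rewrite ler_wpM2l ?(ltW eps0)// ler_pM ?mulr_ge0 ?exprn_ge0//; try lra.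
by rewrite ler_wpM2l// exprn_ge0// ltW.
Qed.

Lemma strict_diff_affine D E g (c v p : R[i]) :
  (forall w, E w -> D (c + w * v)) -> strict_diff D g (c + p * v) ->
  strict_diff E (fun w => g (c + w * v)) p.
Proof.
move=> ED [A gA]; exists (A * v) => eps eps0.
(* The added 1 covers [v = 0], the case of a segment reduced to its centre. *)
have K0 : 0 < normc v + 1 by rewrite ltr_wpDl// normc_ge0.
have [rho rho0 H] := gA (eps / (normc v + 1)) (divr_gt0 eps0 K0).
exists (rho / (normc v + 1)); first exact: divr_gt0.
have sub (x y : R[i]) : c + x * v - (c + y * v) = (x - y) * v by ring.
have near w : normc (w - p) < rho / (normc v + 1) ->
    normc (c + w * v - (c + p * v)) < rho.
  rewrite ltr_pdivlMr// sub normcM; apply: le_lt_trans.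
  by rewrite ler_wpM2l ?normc_ge0// lerDl.
move=> w w' Ew Ew' wp wp'.
have := H _ _ (ED _ Ew) (ED _ Ew') (near _ wp) (near _ wp').
rewrite sub (_ : A * ((w' - w) * v) = A * v * (w' - w)); last by ring.
move=> /le_trans; apply; rewrite normcM -mulrA ler_wpM2l ?(ltW eps0)//.
rewrite mulrCA -[leRHS]mulr1 ler_wpM2l ?normc_ge0//.
by rewrite mulrC ler_pdivrMr// mul1r lerDl.
Qed.

End StrictDiff.

Section MeanValue.
Context {R : realType}.
Implicit Types (g : R[i] -> R[i]) (t eps : R).

Definition expi t : R[i] := cos t +i* sin t.

Lemma expi0 : expi 0 = 1.
Proof. by rewrite /expi cos0 sin0. Qed.

Lemma expiD s t : expi (s + t) = expi s * expi t.
Proof.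
by rewrite /expi cosD sinD; apply/eqP; rewrite eq_complex /= !eqxx /= addrC.
Qed.

Lemma expiMn t n : expi (t *+ n) = expi t ^+ n.
Proof.
by elim: n => [|n ih]; rewrite ?mulr0n ?expi0// mulrS exprS expiD ih.
Qed.

Lemma normc_expi t : normc (expi t) = 1.
Proof. by rewrite /= cos2Dsin2 sqrtr1. Qed.

Lemma expi2pi : expi (pi *+ 2) = 1.
Proof. by rewrite /expi cos2pi sin2pi. Qed.

Lemma expi_near1 eps : 0 < eps -> exists2 tau, 0 < tau &
  forall t, `|t| < tau -> normc (expi t - 1) <= eps.
Proof.
move=> eps0; have e20 : 0 < eps / 2 by rewrite divr_gt0.
have /cvgrPdist_le/(_ _ e20) : cos t @[t --> (0 : R)] --> cos (0 : R).
  exact: continuous_cos.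
have /cvgrPdist_le/(_ _ e20) : sin t @[t --> (0 : R)] --> sin (0 : R).
  exact: continuous_sin.
move=> /nbhs_normP[a a0 Hs] /nbhs_normP[b b0 Hc].
exists (Num.min a b); first by rewrite lt_min a0.
move=> t; rewrite lt_min => /andP[ta tb].
have h1 : `|sin 0 - sin t| <= eps / 2 by apply: Hs; rewrite /= sub0r normrN.
have h2 : `|cos 0 - cos t| <= eps / 2 by apply: Hc; rewrite /= sub0r normrN.
rewrite [X in normc X](_ : _ = (cos t - cos 0) +i* (sin t - sin 0)); last first.
  by rewrite cos0 sin0.
rewrite (le_trans (normc_le_coord _ _))// [leRHS]splitr.
by rewrite lerD// distrC.
Qed.

(** For N > 2 the angle is strictly between 0 and pi, where the sine is positive. *)
Lemma expi_neq1 N : (2 < N)%N -> expi (pi *+ 2 / N%:R) != 1.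
Proof.
move=> N2; have N0 : 0 < (N%:R : R) by rewrite ltr0n (leq_trans _ N2).
rewrite eq_complex negb_and /=; apply/orP; right; apply/negbT/gt_eqF.
apply: sin_gt0_pi; apply/andP; split.
  by rewrite divr_gt0// mulrn_wgt0// pi_gt0.
by rewrite ltr_pdivrMr// -[pi *+ 2]mulr_natr ltr_pM2l ?pi_gt0// ltr_nat.
Qed.

Local Notation unit_disc := [set w : R[i] | normc w <= 1].

(** By compactness one radius serves all centres. The slope attached to a point is borrowed from a
    nearby centre of the covering, so [A] depends on [eps] and need not be the derivative. *)
Lemma uniform_strict_diff g : (forall p, unit_disc p -> strict_diff unit_disc g p) ->
  forall eps, 0 < eps -> exists2 d : R, 0 < d & exists A : R[i] -> R[i],
    forall p w w', unit_disc p -> unit_disc w -> unit_disc w' ->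
      normc (w - p) < d -> normc (w' - p) < d ->
      normc (g w' - g w - A p * (w' - w)) <= eps * normc (w' - w).
Proof.
move=> dg eps eps0.
pose P (d : R) (p : R[i]) := exists A : R[i], forall w w',
  unit_disc w -> unit_disc w' -> normc (w - p) < d -> normc (w' - p) < d ->
  normc (g w' - g w - A * (w' - w)) <= eps * normc (w' - w).
have [|d d0 H] := annulus_uniform 0 1 P.
  move=> p /andP[_ p1]; have [A /(_ _ eps0)[rho rho0 H]] := dg p p1.
  exists (rho / 2); first exact: divr_gt0.
  move=> d q /andP[d0 drho] _ qp; exists A => w w' Dw Dw' wq wq'.
  apply: H => //.
    by have := normc_dist_trans w q p; lra.
  by have := normc_dist_trans w' q p; lra.
exists d => //.
have /choice[A HA] : forall p, exists A : R[i], unit_disc p -> forall w w',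
  unit_disc w -> unit_disc w' -> normc (w - p) < d -> normc (w' - p) < d ->
  normc (g w' - g w - A * (w' - w)) <= eps * normc (w' - w).
  move=> p; have [p1|/negP p1] := boolP (normc p <= 1); last by exists 0.
  by have [|A HA] := H p; [rewrite normc_ge0|exists A].
by exists A => p w w' Dp; apply: HA.
Qed.

(* The sums over [r * w ^+ k] do not depend on [r], up to [eps]: to first order
   their derivative in [r] is a multiple of the increment along the circle
   from [r * w ^+ k] to [r * w ^+ k.+1], and those increments telescope to 0. *)
Lemma mean_value g : (forall p, unit_disc p -> strict_diff unit_disc g p) ->
  forall eps, 0 < eps -> exists2 tau : R, 0 < tau & forall N, (2 < N)%N ->
    pi *+ 2 / N%:R < tau ->
    normc (\sum_(k < N) (g (expi (pi *+ 2 / N%:R) ^+ k) - g 0)) <= eps * N%:R.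
Proof.
move=> dg eps eps0.
have eps20 : 0 < eps / 2 by rewrite divr_gt0.
have [d d0 [A HA]] := uniform_strict_diff g dg _ eps20.
have d20 : 0 < d / 2 by rewrite divr_gt0.
have [tau tau0 Htau] := expi_near1 _ d20.
exists tau => // N N2 Ntau.
have N0 : 0 < (N%:R : R) by rewrite ltr0n (leq_trans _ N2).
set w := expi _; have w1 : w != 1 := expi_neq1 _ N2.
have nw : normc w = 1 := normc_expi _.
have nwk k : normc (w ^+ k) = 1 by rewrite normcX nw expr1n.
have wN : w ^+ N = 1 by rewrite /w -expiMn -[_ *+ N]mulr_natr divfK ?expi2pi// gt_eqF.
have dw : normc (w - 1) < d.
  have /Htau : `|pi *+ 2 / N%:R| < tau.
    by rewrite ger0_norm// divr_ge0// mulrn_wge0// pi_ge0.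
  by rewrite -/w => /le_lt_trans; apply; rewrite ltr_pdivrMr// ltr_pMr// ltr1n.
have inD r : 0 <= r <= 1 -> forall k, normc (r%:C * w ^+ k) = r.
  by move=> /andP[r0 r1] k; rewrite normcM normc_real nwk mulr1 ger0_norm.
pose S r := \sum_(k < N) g (r%:C * w ^+ k).
have tangent r : 0 <= r <= 1 ->
    normc (\sum_(k < N) A (r%:C * w ^+ k) * w ^+ k) <= eps / 2 * N%:R.
  move=> r01; have [->|r_neq0] := eqVneq r 0.
    under eq_bigr do rewrite mul0r.
    rewrite -mulr_sumr (_ : \sum_(k < N) w ^+ k = 0).
      by rewrite mulr0 normc0 mulr_ge0// ltW.
    have /eqP := subrX1 w N; rewrite wN subrr eq_sym mulf_eq0 subr_eq0.
    by rewrite (negPf w1) => /eqP.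
  have r0 : 0 < r by rewrite lt_neqAle eq_sym r_neq0; case/andP: r01.
  have rw : 0 < r * normc (w - 1) by rewrite mulr_gt0 ?normc_gt0 ?subr_eq0.
  rewrite -(ler_pM2l rw) -[X in X * _ <= _](_ : normc (r%:C * (w - 1)) = _).
    rewrite -normcM mulr_sumr.
    have tel : \sum_(k < N) (g (r%:C * w ^+ k.+1) - g (r%:C * w ^+ k)) = 0.
      rewrite -(big_mkord xpredT
        (fun k => g (r%:C * w ^+ k.+1) - g (r%:C * w ^+ k))).
      by rewrite telescope_sumr// wN expr0 subrr.
    rewrite -normcN (_ : - _ = \sum_(k < N) (g (r%:C * w ^+ k.+1) -
        g (r%:C * w ^+ k) - r%:C * (w - 1) * (A (r%:C * w ^+ k) * w ^+ k))).
      rewrite (le_trans (normc_sum _ _ _ _))//.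
      apply: (@le_trans _ _ (\sum_(k < N) eps / 2 * (r * normc (w - 1)))).
        apply: ler_sum => k _.
        set u := r%:C * w ^+ k; set u' := r%:C * w ^+ k.+1.
        have step : u' - u = r%:C * (w - 1) * w ^+ k by rewrite /u' exprS /u; ring.
        have nstep : normc (u' - u) = r * normc (w - 1).
          by rewrite step !normcM normc_real nwk mulr1 ger0_norm// ltW.
        have := HA u u u'; rewrite nstep subrr normc0 /= !inD//.
        rewrite (_ : A u * (u' - u) = r%:C * (w - 1) * (A u * w ^+ k)); last first.
          by rewrite step; ring.
        case/andP: r01 => _ r1; apply => //.
        by rewrite (le_lt_trans _ dw)// ler_piMl ?normc_ge0.
      rewrite sumr_const card_ord -mulr_natr.
      by rewrite le_eqVlt; apply/orP; left; apply/eqP; ring.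
    by rewrite sumrB tel sub0r.
  by rewrite normcM normc_real gtr0_norm.
have step r r' : 0 <= r <= 1 -> 0 <= r' <= 1 -> 0 <= r' - r < d ->
    normc (S r' - S r) <= eps * N%:R * (r' - r).
  move=> r01 r01' /andP[rr' rd].
  set T := \sum_(k < N) A (r%:C * w ^+ k) * w ^+ k.
  have -> : S r' - S r = \sum_(k < N) (g (r'%:C * w ^+ k) - g (r%:C * w ^+ k) -
      A (r%:C * w ^+ k) * (r'%:C * w ^+ k - r%:C * w ^+ k)) + T * (r' - r)%:C.
    rewrite mulr_suml -sumrB -big_split /=; apply: eq_bigr => k _.
    by rewrite rmorphB /=; ring.
  rewrite (le_trans (normcD _ _))// normcM normc_real (ger0_norm rr').
  have -> : eps * N%:R * (r' - r) =
      eps / 2 * (r' - r) * N%:R + eps / 2 * N%:R * (r' - r) by field.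
  apply: lerD; last by rewrite ler_wpM2r ?tangent.
  rewrite (le_trans (normc_sum _ _ _ _))//.
  apply: (@le_trans _ _ (\sum_(k < N) eps / 2 * (r' - r))).
    apply: ler_sum => k _.
    set u := r%:C * w ^+ k; set u' := r'%:C * w ^+ k.
    have nstep : normc (u' - u) = r' - r.
      by rewrite -mulrBl -rmorphB normcM nwk mulr1 normc_real ger0_norm.
    have := HA u u u'; rewrite nstep subrr normc0 /= !inD//.
    by case/andP: r01 => ? ?; case/andP: r01' => ? ?; apply.
  by rewrite sumr_const card_ord -[leLHS]mulr_natr.
(* [step] compares only radii closer than [d], so the way from radius 0 to radius 1 is cut into
   [m.+1] equal steps; their errors add up to [eps * N%:R] whatever [m] is. *)
have [m dm] : exists m : nat, m.+1%:R^-1 < d.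
  have /cvgrPdist_lt/(_ _ d0)[m _ /(_ m (leqnn m))] := @cvg_harmonic R.
  by rewrite /harmonic /= sub0r normrN ger0_norm// => ?; exists m.
have chain j : (j <= m.+1)%N ->
    normc (S (j%:R / m.+1%:R) - S 0) <= eps * N%:R * (j%:R / m.+1%:R).
  have m0 : 0 < m.+1%:R :> R by rewrite ltr0n.
  elim: j => [_|j ih jm]; first by rewrite !mul0r subrr normc0 mulr0.
  have bnd i : (i <= m.+1)%N -> 0 <= (i%:R / m.+1%:R : R) <= 1.
    by move=> im; rewrite divr_ge0 ?ler0n//= ler_pdivrMr// mul1r ler_nat.
  have dj : j.+1%:R / m.+1%:R - j%:R / m.+1%:R = m.+1%:R^-1 :> R.
    by rewrite -mulrBl -natr1 addrAC subrr add0r mul1r.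
  rewrite (le_trans (normc_dist_trans _ (S (j%:R / m.+1%:R)) _))//.
  have := step (j%:R / m.+1%:R) (j.+1%:R / m.+1%:R).
  rewrite dj dm invr_ge0 (ltW m0) !bnd ?(ltnW jm)// => /(_ isT isT isT) h.
  rewrite (le_trans (lerD h (ih (ltnW jm))))//.
  by rewrite -mulrDr (_ : _^-1 + _ = j.+1%:R / m.+1%:R)// -[j.+1%:R]natr1 mulrDl mul1r addrC.
have := chain m.+1 (leqnn _); rewrite divff ?pnatr_eq0// mulr1.
rewrite /S -sumrB; congr (normc _ <= _); apply: eq_bigr => k _.
by rewrite mul1r mul0r.
Qed.

End MeanValue.

(** * Maximum principle and Hopf's lemma *)

Section StrongMaximum.
Context {R : realType}.
Implicit Types (g : R[i] -> R[i]).

Local Notation unit_disc := [set w : R[i] | normc w <= 1].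

(** Expanding |b - a|^2 and replacing |b|^2 by |a|^2 leaves an expression affine in [b], to which
    averaging applies. With the maximum of the modulus at the centre, a small mean of g - g(0) thus
    forces a small mean square. *)
Lemma sqr_normcB_le (a b : R[i]) : normc b <= normc a ->
  normc (b - a) ^+ 2 <= 2 * complex.Re (a^* * (a - b)).
Proof.
move=> ba; have : normc b ^+ 2 <= normc a ^+ 2.
  by rewrite ler_pXn2r ?nnegrE ?normc_ge0.
rewrite !sqr_normc2 {ba}.
by case: a b => [x y] [u v] /=; nra.
Qed.

Lemma exists_natr_inv_lt (c d : R) : 0 < c -> 0 < d ->
  exists2 n : nat, (2 < n)%N & c / n%:R < d.
Proof.
move=> c0 d0; have [m _ /(_ m (leqnn m))] : \forall n \near \oo, `|0 - harmonic n| < d / c.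
  by apply: (cvgrPdist_lt (F := _) _ _).1 (divr_gt0 d0 c0); exact: cvg_harmonic.
rewrite /= sub0r normrN ger0_norm// => hm; exists m.+3 => //.
rewrite mulrC -ltr_pdivlMr// (le_lt_trans _ hm)// lef_pV2 ?posrE ?ltr0n//.
by rewrite ler_nat -[m.+3](addn2 m.+1) leq_addr.
Qed.

(** If g(1) differed from g(0) by [d], then [g] would stay at distance d/2 from g(0) on an arc at 1
    holding a fixed proportion 1/L of the roots of unity. The mean square of g - g(0) would then
    stay away from 0, against the mean value property. *)
Lemma strong_max_unit g : (forall p, unit_disc p -> strict_diff unit_disc g p) ->
  (forall w, unit_disc w -> normc (g w) <= normc (g 0)) -> g 1 = g 0.
Proof.
move=> dg gmax; apply: contrapT => /eqP; rewrite -subr_eq0 -normc_gt0.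
set d := normc _ => d0.
have D1 : unit_disc (1 : R[i]) by rewrite /mkset normc1.
have d20 : 0 < d / 2 by rewrite divr_gt0.
have [rho rho0 Hrho] := strict_diff_cont _ _ _ D1 (dg _ D1) _ d20.
have rho20 : 0 < rho / 2 by rewrite divr_gt0.
have [tau1 tau10 Htau1] := expi_near1 _ rho20.
have pi20 : 0 < (pi : R) *+ 2 by rewrite mulrn_wgt0// pi_gt0.
have [L L2 HL] := exists_natr_inv_lt _ _ pi20 tau10.
have L0 : 0 < L%:R :> R by rewrite ltr0n (leq_trans _ L2).
set M := normc (g 0) + 1.
have M0 : 0 < M by rewrite ltr_wpDl// normc_ge0.
(* With N = m L the upper bound 2 M eps N becomes m d^2 / 8, half of the lower bound m (d/2)^2 given
   by the [m] roots on the arc. *)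
pose eps := d ^+ 2 / (16 * L%:R * M).
have eps0 : 0 < eps by rewrite divr_gt0 ?exprn_gt0// !mulr_gt0.
have [tau tau0 Htau] := mean_value _ dg _ eps0.
have [m m2 Hm] := exists_natr_inv_lt _ _ pi20 tau0.
have m0 : 0 < m%:R :> R by rewrite ltr0n (leq_trans _ m2).
pose N := (m * L)%N.
have N2 : (2 < N)%N by rewrite (leq_trans m2)// leq_pmulr// (leq_trans _ L2).
have N0 : 0 < N%:R :> R by rewrite ltr0n (leq_trans _ N2).
set t : R := pi *+ 2 / N%:R.
have tpos : 0 < t by rewrite divr_gt0.
have ttau : t < tau.
  rewrite (le_lt_trans _ Hm)// ler_pM2l// lef_pV2 ?posrE// ler_nat.
  by rewrite leq_pmulr// (leq_trans _ L2).
have := Htau N N2 ttau; rewrite -/t; set S := \sum_(k < N) _ => HS.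
have upper : \sum_(k < N) normc (g (expi t ^+ k) - g 0) ^+ 2 <=
    2 * (M * (eps * N%:R)).
  have : \sum_(k < N) normc (g (expi t ^+ k) - g 0) ^+ 2 <=
      \sum_(k < N) 2 * complex.Re ((g 0)^* * (g 0 - g (expi t ^+ k))).
    apply: ler_sum => k _; apply/sqr_normcB_le/gmax.
    by rewrite /= normcX normc_expi expr1n.
  move=> /le_trans; apply; rewrite -mulr_sumr ler_wpM2l//.
  have -> : \sum_(k < N) complex.Re ((g 0)^* * (g 0 - g (expi t ^+ k))) =
      complex.Re ((g 0)^* * - S).
    rewrite /S -sumrN mulr_sumr.
    rewrite (big_morph _ (raddfD (@complex.Re R : Rcomplex R -> R)) (raddf0 _)).
    by apply: eq_bigr => k _; rewrite opprB.
  rewrite (le_trans (Re_le_normc _))// normcM normcN normc_conj.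
  by rewrite ler_pM ?normc_ge0// lerDl.
have lower : m%:R * (d / 2) ^+ 2 <=
    \sum_(k < N) normc (g (expi t ^+ k) - g 0) ^+ 2.
  rewrite -(big_mkord xpredT (fun k => normc (g (expi t ^+ k) - g 0) ^+ 2)).
  rewrite (@big_cat_nat _ _ _ m)//=; last by rewrite leq_pmulr// (leq_trans _ L2).
  rewrite -[leLHS]addr0 lerD// ?sumr_ge0// => [|k _]; last exact: sqr_ge0.
  rewrite mulrC mulr_natr -[leLHS](_ : \sum_(0 <= k < m) (d / 2) ^+ 2 = _).
    rewrite ler_sum_nat// => k /andP[_ km].
    rewrite ler_pXn2r ?nnegrE ?normc_ge0 ?(ltW d20)//.
    have : normc (g (expi t ^+ k) - g 1) <= d / 2.
      apply: Hrho; first by rewrite /= normcX normc_expi expr1n.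
      rewrite -expiMn (le_lt_trans (Htau1 _ _))//; last lra.
      rewrite ger0_norm ?mulrn_wge0 ?(ltW tpos)// (le_lt_trans _ HL)//.
      have -> : t *+ k = pi *+ 2 / L%:R * (k%:R / m%:R).
        rewrite -[t *+ k]mulr_natr /t /N natrM; field.
        by rewrite !gt_eqF.
      rewrite ler_piMr ?divr_ge0 ?(ltW pi20) ?(ltW L0)//.
      by rewrite ler_pdivrMr// mul1r ler_nat ltnW.
    have := normc_dist_trans (g 1) (g (expi t ^+ k)) (g 0).
    by rewrite -/d (normc_distC (g 1)); lra.
  by rewrite big_const_nat subn0 iter_addr_0.
have := le_trans lower upper.
have -> : 2 * (M * (eps * N%:R)) = m%:R * (d ^+ 2 / 8).
  by rewrite /eps /N natrM; field; rewrite !gt_eqF.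
rewrite ler_pM2l//; have := exprn_gt0 2 d0; rewrite expr_div_n; lra.
Qed.

(** Each [w] is the image of 1 under u |-> c + u (w - c), which maps the unit disc into the given
    disc; this is why comparing the centre with the single point 1 was enough. *)
Lemma strong_max g (c : R[i]) (r : R) : 0 <= r ->
  (forall p, normc (p - c) <= r ->
     strict_diff [set w | normc (w - c) <= r] g p) ->
  (forall w, normc (w - c) <= r -> normc (g w) <= normc (g c)) ->
  forall w, normc (w - c) <= r -> g w = g c.
Proof.
move=> r0 dg gmax w wr.
have sub u : unit_disc u -> normc (c + u * (w - c) - c) <= r.
  move=> /= u1; rewrite addrAC subrr add0r normcM (le_trans _ wr)//.
  by rewrite ler_piMl ?normc_ge0.
have : g (c + 1 * (w - c)) = g (c + 0 * (w - c)); last first.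
  by rewrite mul1r mul0r addr0 [c + _]addrC subrK.
apply: (strong_max_unit (fun u => g (c + u * (w - c)))) => [p p1|u u1].
  by apply: (strict_diff_affine _ _ _ _ _ _ sub); exact/dg/sub.
by rewrite mul0r addr0; exact/gmax/sub.
Qed.

End StrongMaximum.

Section Hopf.
Context {R : realType}.

(** Two uses of [annulus_uniform]: with [d] as the inverse of an upper bound, [F] is bounded; with
    [d] as a gap below the supremum, a supremum that is not attained could be lowered. *)
Lemma annulus_argmax (a b : R) (F : R[i] -> R) : (exists p, a <= normc p <= b) ->
  (forall p, a <= normc p <= b -> forall eps, 0 < eps ->
     exists2 rho : R, 0 < rho & forall q, a <= normc q <= b ->
       normc (q - p) < rho -> `|F q - F p| <= eps) ->
  exists2 z, a <= normc z <= b & forall w, a <= normc w <= b -> F w <= F z.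
Proof.
move=> [p0 p0K] cF.
have [|B B0 HB] := annulus_uniform a b (fun d q => F q <= d^-1).
  move=> p pK; have [rho rho0 H] := cF p pK 1 ltr01.
  have K0 : 0 < `|F p| + 1 by rewrite ltr_wpDl.
  exists (Num.min rho (`|F p| + 1)^-1); first by rewrite lt_min rho0 invr_gt0.
  move=> d q /andP[d0]; rewrite !lt_min => /andP[_ d1] qK /andP[qp _].
  have := H q qK qp; rewrite ler_norml => /andP[_ h].
  have : `|F p| + 1 <= d^-1 by rewrite -[leLHS]invrK lef_pV2 ?posrE ?invr_gt0// ltW.
  by have := ler_norm (F p); lra.
have supF : has_sup (F @` [set q | a <= normc q <= b]).
  split; first by exists (F p0), p0.
  by exists B^-1 => _ [q qK <-]; exact: HB.
set S := sup (F @` [set q | a <= normc q <= b]).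
apply: contrapT => noargmax.
have FS q : a <= normc q <= b -> F q < S.
  move=> qK; have FqS : F q <= S by apply: sup_upper_bound => //; exists q.
  rewrite lt_neqAle FqS andbT; apply/eqP => FqE; apply: noargmax.
  exists q => // w wK; rewrite FqE; apply: sup_upper_bound => //; by exists w.
have [|d d0 Hd] := annulus_uniform a b (fun d q => F q <= S - d).
  move=> p pK; have e0 : 0 < (S - F p) / 2 by rewrite divr_gt0// subr_gt0 FS.
  have [rho rho0 H] := cF p pK _ e0.
  exists (Num.min rho ((S - F p) / 2)); first by rewrite lt_min rho0.
  move=> d q /andP[d0]; rewrite !lt_min => /andP[_ d1] qK /andP[qp _].
  have := H q qK qp; rewrite ler_norml => /andP[_ h]; lra.
have : S <= S - d.
  by apply: ge_sup; [case: supF|move=> _ [q qK <-]; exact: Hd].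
lra.
Qed.

Local Notation unit_disc := [set w : R[i] | normc w <= 1].

(** The maximum principle starts from a centre, so two discs are needed: the one of radius 1/2 about
    [z] stays in the unit disc and reaches 0, which becomes a maximum point too; the unit disc about
    0 then makes [g] constant. *)
Lemma disc_subset_strict_max (g : R[i] -> R[i]) :
  (forall p, unit_disc p -> strict_diff unit_disc g p) ->
  (forall w, unit_disc w -> normc (g w) <= 1) ->
  ~ (exists c, forall w, unit_disc w -> g w = c) ->
  forall z, normc z <= 1 / 2 -> normc (g z) < 1.
Proof.
move=> dg g1 gcst z z2; have z1 : normc z <= 1 by lra.
rewrite lt_neqAle g1// andbT; apply/eqP => gz1; apply: gcst.
have g0z : g 0 = g z.
  apply: (strong_max g z (1 / 2)) => //; last by rewrite sub0r normcN.
    move=> p pz; apply: (@strict_diffS _ _ unit_disc).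
      by move=> w /= wz; have := ler_normc_dist w z; lra.
    by apply: dg => /=; have := ler_normc_dist p z; lra.
  move=> w wz; rewrite gz1; apply: g1 => /=.
  by have := ler_normc_dist w z; lra.
have disc0 : [set w : R[i] | normc (w - 0) <= 1] = unit_disc.
  by apply/seteqP; split => w /=; rewrite subr0.
exists (g 0) => w w1; apply: (strong_max g 0 1) => //; last by rewrite subr0.
  by move=> p; rewrite subr0 disc0; exact: dg.
by move=> u; rewrite subr0 g0z gz1; exact: g1.
Qed.

(* Hopf's boundary lemma: compare [g ^+ N] with the identity on the annulus
   [1/2 <= |w| <= 1]. At a maximum point of [|g ^+ N / w|] the largest disc of the
   annulus centred there touches the boundary, and the quotient is constant on
   that disc. *)
Lemma hopf (g : R[i] -> R[i]) :
  (forall p, unit_disc p -> strict_diff unit_disc g p) ->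
  (forall w, unit_disc w -> normc (g w) <= 1) ->
  ~ (exists c, forall w, unit_disc w -> g w = c) ->
  exists N : nat, forall w, 1 / 2 <= normc w <= 1 -> normc (g w) ^+ N <= normc w.
Proof.
move=> dg g1 gcst; have gin := disc_subset_strict_max g dg g1 gcst.
have cg p (Dp : unit_disc p) := strict_diff_cont _ _ _ Dp (dg p Dp).
have [|d d0 Hd] := annulus_uniform 0 (1 / 2) (fun d q => normc (g q) <= 1 - d).
  move=> p /andP[_ p2]; have p1 : unit_disc p by rewrite /mkset; lra.
  have e0 : 0 < (1 - normc (g p)) / 2 by rewrite divr_gt0// subr_gt0 gin.
  have [rho rho0 H] := cg p p1 _ e0.
  exists (Num.min rho ((1 - normc (g p)) / 2)); first by rewrite lt_min rho0.
  move=> d q /andP[d0]; rewrite !lt_min => /andP[_ d1] /andP[_ q2] /andP[qp _].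
  have q1 : unit_disc q by rewrite /mkset; lra.
  by have := H q q1 qp; have := ler_normc_dist (g q) (g p); lra.
have {Hd} gd q : normc q <= 1 / 2 -> normc (g q) <= 1 - d.
  by move=> q2; apply: Hd; rewrite normc_ge0.
have d1 : d <= 1.
  have := gd 0; rewrite normc0; have := normc_ge0 (g 0); lra.
(* On the inner circle this yields |g|^N <= 1/2 = |w|, so the quotient is at most 1 on both boundary
   circles. *)
have [N HN] : exists N : nat, (1 - d) ^+ N <= 1 / 2.
  have cv : (1 - d) ^+ n @[n --> \oo] --> (0 : R).
    by apply: cvg_expr; rewrite ger0_norm; lra.
  have /cvgrPdist_le/(_ (1 / 2)) := cv => /(_ ltac:(lra))[n _ /(_ n (leqnn n))].
  by rewrite /= sub0r normrN => h; exists n; rewrite (le_trans (ler_norm _) h).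
exists N.
pose h w := g w ^+ N * w^-1.
have dh p : 1 / 2 <= normc p <= 1 -> strict_diff [set w | 1 / 2 <= normc w <= 1] h p.
  move=> /[dup] pK /andP[p2 p1]; apply: strict_diffM => //.
    apply: strict_diffX => //; apply: strict_diffS (dg p p1) => w /=.
    by case/andP.
  by apply: strict_diffV; rewrite -normc_gt0; lra.
have hE w : 1 / 2 <= normc w -> normc (h w) = normc (g w) ^+ N / normc w.
  by rewrite normcM normcX normcV.
have [||z /andP[z2 z1] zmax] := annulus_argmax (1 / 2) 1 (fun w => normc (h w)).
- by exists 1; rewrite normc1; lra.
- move=> p pK eps eps0.
  have [//|rho rho0 H] := strict_diff_cont _ _ _ _ (dh p pK) _ eps0.
  exists rho => // q qK qp; have := H q qK qp => hq.
  rewrite ler_norml; have := ler_normc_dist (h q) (h p).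
  by have := ler_normc_dist (h p) (h q); rewrite (normc_distC (h p)); lra.
have z0 : 0 < normc z by lra.
suff hz : normc (h z) <= 1.
  move=> w wK; have := zmax w wK; case/andP: wK => w2 w1.
  rewrite hE// ler_pdivrMr; last lra.
  by move=> /le_trans; apply; rewrite ler_piMl ?normc_ge0.
have bdry w : normc w = 1 \/ normc w = 1 / 2 -> normc (h w) <= 1.
  move=> [] wE; rewrite hE ?wE//; try lra.
    by rewrite divr1 exprn_ile1 ?normc_ge0// g1// /mkset wE.
  rewrite ler_pdivrMr ?[1 * (1 / 2)]mul1r; last lra.
  rewrite (le_trans _ HN)// lerXn2r ?nnegrE ?normc_ge0 ?subr_ge0//.
  by apply: gd; rewrite wE.
(* [s] is a signed radial displacement: positive towards the unit circle, negative towards the inner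
   one. The nearer circle decides the sign at the end. *)
have touch (s : R) : `|s| <= 1 - normc z -> `|s| <= normc z - 1 / 2 ->
    h (z + (s / normc z)%:C * z) = h z.
  move=> s1 s2.
  have sub w : normc (w - z) <= `|s| -> 1 / 2 <= normc w <= 1.
    move=> wz; have := ler_normc_dist w z; have := ler_normc_dist z w.
    by rewrite (normc_distC z); lra.
  apply: (strong_max h z `|s|) => //.
  - move=> p pz; apply: strict_diffS (dh p (sub p pz)) => w; exact: sub.
  - by move=> w wz; apply/zmax/sub.
  rewrite addrAC subrr add0r normcM normc_real normrM normfV.
  by rewrite (gtr0_norm z0) divfK// gt_eqF.
have normp (s : R) : 0 <= normc z + s ->
    normc (z + (s / normc z)%:C * z) = normc z + s.
  move=> zs.
  rewrite (_ : z + _ = ((normc z + s) / normc z)%:C * z); last first.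
    by rewrite mulrDl divff ?gt_eqF// rmorphD /= mulrDl mul1r.
  rewrite normcM normc_real normrM normfV (ger0_norm zs) (gtr0_norm z0).
  by rewrite divfK// gt_eqF.
have [le12|/ltW le21] := leP (1 - normc z) (normc z - 1 / 2).
  rewrite -(touch (1 - normc z)) ?ger0_norm ?subr_ge0//.
  by apply: bdry; left; rewrite normp; lra.
rewrite -(touch (1 / 2 - normc z)) ?ler0_norm ?subr_le0 ?opprB//.
by apply: bdry; right; rewrite normp; lra.
Qed.

End Hopf.

(** * The derivative where the modulus reaches one *)

Section BoundaryDerivative.
Context {R : realType}.
Local Notation unit_disc := [set w : R[i] | normc w <= 1].

Lemma conjc_mul (z : R[i]) : z^* * z = (normc z ^+ 2)%:C.
Proof.
rewrite sqr_normc2; case: z => x y /=; apply/eqP; rewrite eq_complex /=.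
by apply/andP; split; apply/eqP; ring.
Qed.

Lemma bernoulli_sub (x : R) n : 0 <= x <= 1 -> 1 - n%:R * x <= (1 - x) ^+ n.
Proof.
move=> /andP[x0 x1]; elim: n => [|n ih]; first by rewrite mul0r subr0 expr0.
have n0 : 0 <= n%:R :> R by [].
rewrite exprS -natr1 (le_trans _ (ler_wpM2l _ ih)) ?subr_ge0//.
by have := mulr_ge0 (mulr_ge0 n0 x0) x0; nra.
Qed.

(** If the real part were nonpositive, then |g| >= 1 - eps s at (1 - s) zeta for small s. Hopf's
    bound and Bernoulli's inequality then give 1 - N eps s <= 1 - s, which fails as soon as N eps <
    1. The slope [A] is a parameter because the same one governs the increments of [f] in several
    variables. *)
Lemma hopf_derivative (g : R[i] -> R[i]) (zeta eta A : R[i]) :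
  (forall p, unit_disc p -> strict_diff unit_disc g p) ->
  (forall w, unit_disc w -> normc (g w) <= 1) ->
  ~ (exists c, forall w, unit_disc w -> g w = c) ->
  normc zeta = 1 -> normc eta = 1 -> g zeta = eta ->
  (forall eps : R, 0 < eps -> exists2 rho : R, 0 < rho & forall w, unit_disc w ->
     normc (w - zeta) < rho ->
     normc (g w - g zeta - A * (w - zeta)) <= eps * normc (w - zeta)) ->
  0 < complex.Re (eta^* * (A * zeta)).
Proof.
move=> dg g1 gcst z1 e1 gz gA; rewrite ltNge; apply/negP => a0.
have [N HN] := hopf g dg g1 gcst.
pose eps : R := N.+1%:R^-1.
have eps0 : 0 < eps by rewrite invr_gt0.
have [rho rho0 H] := gA eps eps0.
pose s := Num.min (1 / 2) (rho / 2).
have s0 : 0 < s by rewrite lt_min !divr_gt0.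
have s2 : s <= 1 / 2 by rewrite ge_min lexx.
have srho : s < rho by rewrite gt_min; apply/orP; right; lra.
pose w := (1 - s)%:C * zeta.
have wz : w - zeta = - s%:C * zeta by rewrite /w rmorphB /=; ring.
have nwz : normc (w - zeta) = s.
  by rewrite wz mulNr normcN normcM z1 mulr1 normc_real gtr0_norm.
have nw : normc w = 1 - s.
  by rewrite normcM z1 mulr1 normc_real ger0_norm; lra.
have w1 : unit_disc w by rewrite /mkset nw; lra.
have := H w w1; rewrite nwz gz => /(_ srho) HE.
set E := g w - eta - _ in HE.
have gwE : eta^* * g w = 1 - s%:C * (eta^* * (A * zeta)) + eta^* * E.
  have -> : 1 = eta^* * eta by rewrite conjc_mul e1 expr1n.
  by rewrite /E wz; ring.
have lb : 1 - eps * s <= normc (g w).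
  have -> : normc (g w) = normc (eta^* * g w) by rewrite normcM normc_conj e1 mul1r.
  apply: le_trans (Re_le_normc _); rewrite gwE.
  have : normc (eta^* * E) <= eps * s by rewrite normcM normc_conj e1 mul1r.
  have := Re_le_normc (- (eta^* * E)); rewrite normcN.
  move: (eta^* * E) (eta^* * (A * zeta)) a0 => [x y] [u v] /= u0 h1 h2.
  by have := mulr_le0_ge0 u0 (ltW s0); lra.
have eN : N%:R * eps < 1 by rewrite ltr_pdivrMr// mul1r ltr_nat.
have es1 : 0 <= eps * s <= 1.
  rewrite mulr_ge0 ?(ltW eps0) ?(ltW s0)//=.
  apply: (@le_trans _ _ (1 * s)); last lra.
  by rewrite ler_wpM2r ?(ltW s0)// invf_le1// ler1n.
have := HN w; rewrite nw => /(_ ltac:(lra)).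
have : (1 - eps * s) ^+ N <= normc (g w) ^+ N.
  rewrite lerXn2r ?nnegrE ?normc_ge0 ?subr_ge0//; by case/andP: es1.
have := bernoulli_sub _ N es1.
have := ltr_pM2r s0 (N%:R * eps) 1; rewrite eN => /idP; lra.
Qed.

End BoundaryDerivative.

(** * A mean value inequality for complex derivatives *)

Section ComplexMVT.
Context {R : realType}.

Lemma Re_affine (z w : R[i]) (h : R) :
  complex.Re (z + h%:C * w) = complex.Re z + h * complex.Re w.
Proof. by case: z w => [x y] [u v] /=; ring. Qed.

(** The real mean value theorem is applied to the projection of phi(x) - A x onto its own total
    increment [D]: along the segment this real function grows by |D|^2 with slope at most |D| eps |b
    - a|, and one factor |D| cancels. *)
Lemma complex_mean_value_le (phi : R[i] -> R[i]) (a b A : R[i]) (eps : R) :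
  (forall t : R, 0 <= t <= 1 -> exists2 l : R[i], normc (l - A) <= eps &
     forall e : R, 0 < e -> exists2 rho : R, 0 < rho & forall h, normc h < rho ->
       normc (phi (a + t%:C * (b - a) + h) - phi (a + t%:C * (b - a)) - l * h)
         <= e * normc h) ->
  normc (phi b - phi a - A * (b - a)) <= eps * normc (b - a).
Proof.
move=> dphi; set D := phi b - phi a - _.
have [->|D0] := eqVneq (normc D) 0.
  have [l /(le_trans (normc_ge0 _)) e0 _] := dphi 0 ltac:(lra).
  by rewrite mulr_ge0 ?normc_ge0.
have {}D0 : 0 < normc D by rewrite lt_neqAle eq_sym D0 normc_ge0.
pose x t := a + t%:C * (b - a).
pose F t : R := complex.Re (D^* * (phi (x t) - A * x t)).
have F10 : F 1 - F 0 = normc D ^+ 2.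
  have -> : F 1 - F 0 = complex.Re (D^* * D).
    rewrite -(raddfB (@complex.Re R : Rcomplex R -> R)) /= /x mul1r mul0r addr0.
    by rewrite [a + (b - a)]addrC subrK /D; congr complex.Re; ring.
  by rewrite sqr_normc2; case: (D) => u v /=; ring.
have /choice[df Hdf] : forall t : R, exists d : R, 0 <= t <= 1 ->
    d <= normc D * (eps * normc (b - a)) /\ is_derive t 1 F d.
  move=> t; have [t01|/negP t01] := boolP (0 <= t <= 1); last by exists 0.
  have [l lA Hl] := dphi t t01.
  exists (complex.Re (D^* * ((l - A) * (b - a)))) => _; split.
    rewrite (le_trans (Re_le_normc _))// !normcM normc_conj.
    by rewrite ler_wpM2l ?normc_ge0// ler_wpM2r ?normc_ge0.
  have cF : (fun h : R => h^-1 *: ((F \o shift t) (h *: (1 : R)) - F t)) @ 0^' -->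
      complex.Re (D^* * ((l - A) * (b - a))).
    apply/cvgrPdist_le => e e0.
    have K0 : 0 < normc D * (normc (b - a) + 1).
      by rewrite mulr_gt0// ltr_wpDl// normc_ge0.
    have [rho rho0 H] := Hl _ (divr_gt0 e0 K0).
    have r0 : 0 < rho / (normc (b - a) + 1).
      by rewrite divr_gt0// ltr_wpDl// normc_ge0.
    near=> h.
    have h0 : h != 0 by near: h; exact: nbhs_dnbhs_neq.
    have hr : `|h| < rho / (normc (b - a) + 1).
      near: h; apply: dnbhs0_lt => //.
    have hrho : normc (h%:C * (b - a)) < rho.
      rewrite normcM normc_real (le_lt_trans _ (_ : `|h| * (normc (b - a) + 1) < _))//.
        by rewrite ler_wpM2l// lerDl.
      by rewrite -ltr_pdivlMr// ltr_wpDl// normc_ge0.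
    have := H _ hrho; rewrite normcM normc_real.
    set E := _ - _ - l * _ => HE.
    have -> : (F \o shift t) (h *: 1) - F t =
        complex.Re (D^* * E) + h * complex.Re (D^* * ((l - A) * (b - a))).
      have -> : (F \o shift t) (h *: 1) - F t =
          complex.Re (D^* * (phi (x t + h%:C * (b - a)) - phi (x t) -
             A * (h%:C * (b - a)))).
        rewrite /= /F -(raddfB (@complex.Re R : Rcomplex R -> R)) /=.
        have -> : x (h *: 1 + t) = x t + h%:C * (b - a).
          by rewrite /x [h *: _]mulr1 rmorphD /=; ring.
        by congr complex.Re; ring.
      have -> : D^* * (phi (x t + h%:C * (b - a)) - phi (x t) -
          A * (h%:C * (b - a))) = D^* * E + h%:C * (D^* * ((l - A) * (b - a))).
        by rewrite /E -/(x t); ring.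
      exact: Re_affine.
    rewrite scalerDr [h^-1 *: (h * _)]mulKf// opprD addrCA subrr addr0.
    rewrite normrN normrM normfV mulrC ler_pdivrMr ?normr_gt0//.
    have Re_norm (z : R[i]) : `|complex.Re z| <= normc z.
      rewrite ler_norml Re_le_normc andbT lerNl -normcN.
      by have := Re_le_normc (- z); case: (z).
    rewrite (le_trans (Re_norm _))// normcM normc_conj.
    rewrite (le_trans (ler_wpM2l (normc_ge0 _) HE))// invfM.
    have b0 : 0 < normc (b - a) + 1 by rewrite ltr_wpDl// normc_ge0.
    rewrite (_ : _ * _ = e * `|h| * (normc (b - a) / (normc (b - a) + 1))).
      rewrite ler_piMr ?mulr_ge0 ?(ltW e0)// ler_pdivrMr// mul1r lerDl//.
    by field; rewrite !gt_eqF.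
  by apply: DeriveDef; [exact: cvgP cF|exact: cvg_lim cF].
have F01 (t : R) : 0 <= t <= 1 -> is_derive t 1 F (df t) by move=> /Hdf[].
have [||c /[!in_itv]/=/andP[c0 c1]] := @MVT R F df 0 1 ltr01.
- move=> t /[!in_itv]/=/andP[t0 t1]; apply: F01; lra.
- apply: derivable_within_continuous => t /[!in_itv]/= t01.
  by have [] := F01 t t01.
rewrite F10 subr0 mulr1 => DE.
have [+ _] := Hdf c ltac:(lra).
by rewrite -DE expr2 ler_pM2l.
Unshelve. all: by end_near. Qed.

End ComplexMVT.

(** * Functions on the closed polydisc *)

Section PartialStrictDiff.
Context {R : realType} {n : nat}.
Implicit Types (f g : 'rV[R[i]]_n -> R[i]) (z p : 'rV[R[i]]_n) (j k : 'I_n).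

Lemma normr_ltE (x : R[i]) (r : R) : (`|x| < r%:C) = (normc x < r).
Proof. by rewrite -ltcR; reflexivity. Qed.

Lemma normr_leE (x : R[i]) (r : R) : (`|x| <= r%:C) = (normc x <= r).
Proof. by rewrite -lecR; reflexivity. Qed.

Lemma polydiscP z : polydisc z <-> forall k, normc (z 0 k) < 1.
Proof.
by split => H k; have := H k; rewrite -(normr_ltE _ 1); exact.
Qed.

Lemma closed_polydiscP z : closed_polydisc z <-> forall k, normc (z 0 k) <= 1.
Proof.
by split => H k; have := H k; rewrite -(normr_leE _ 1); exact.
Qed.

(** Balls over [R[i]] have radii in [R[i]]; this returns them to [R]. *)
Lemma pos_complexP (r : R[i]) : 0 < r -> exists2 s : R, 0 < s & r = s%:C.
Proof.
by case: r => a b; rewrite ltcE /= => /andP[/eqP -> a0]; exists a.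
Qed.

Lemma within_closed_polydisc_le g :
  {within @closed_polydisc R n, continuous g} ->
  forall p, closed_polydisc p -> forall eps : R, 0 < eps ->
  exists2 rho : R, 0 < rho & forall z, closed_polydisc z ->
    (forall k, normc (z 0 k - p 0 k) < rho) -> normc (g z - g p) <= eps.
Proof.
move=> /subspace_continuousP cg p pD eps eps0.
have eps0' : 0 < eps%:C by rewrite ltcR.
have /cvgrPdist_le/(_ _ eps0') := cg p pD.
rewrite near_withinE => /nbhs_ballP[_ /pos_complexP[rho rho0 ->]] H.
exists rho => // z zD zp; have := H z; rewrite /= normc_distC.
rewrite -normr_leE; apply => //; split => [|i k]; first by rewrite ltcR.
by rewrite ord1; rewrite /ball /= distrC normr_ltE.
Qed.

(** Frechet differentiability gives a complex derivative along the j-th axis, and restricting its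
    increment to real values identifies it with [l]. A continuous extension of the x_j-derivative is
    thereby one of the complex derivative. *)
Lemma holomorphic_partial f z j (l : R[i]) : differentiable f z ->
  is_real_derive f z (1 *: delta_mx 0 j) l ->
  forall e : R, 0 < e -> exists2 rho : R, 0 < rho & forall h : R[i],
    normc h < rho -> normc (f (z + h *: delta_mx 0 j) - f z - l * h) <= e * normc h.
Proof.
move=> df dl; rewrite scale1r in dl.
set v : 'rV[R[i]]_n := delta_mx 0 j in dl *.
have dv : derivable f z v by exact: diff_derivable.
set d := 'D_v f z.
have Hd (e : R) : 0 < e -> exists2 rho : R, 0 < rho & forall h : R[i], h != 0 ->
    normc h < rho -> normc (h^-1 * (f (z + h *: v) - f z) - d) <= e.
  move=> e0; have e0' : 0 < e%:C by rewrite ltcR.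
  have /cvgrPdist_le/(_ _ e0') : h^-1 *: ((f \o shift z) (h *: v) - f z) @[h --> 0^'] --> d.
    exact: dv.
  rewrite /dnbhs near_withinE => /nbhs_ballP[_ /pos_complexP[rho rho0 ->]] H.
  exists rho => // h h0 hr; have := H h.
  rewrite /= normr_leE normc_distC [h *: v + z]addrC; apply => //.
  by rewrite /ball /= sub0r normrN normr_ltE.
have ld : d = l.
  apply/eqP; rewrite -subr_eq0 -normc_eq0 eq_le normc_ge0 andbT.
  apply/ler_addgt0Pr => e e0; rewrite add0r.
  have e20 : 0 < e / 2 by rewrite divr_gt0.
  have [rho rho0 H] := Hd _ e20.
  have e20' : 0 < (e / 2)%:C by rewrite ltcR.
  have /cvgrPdist_le/(_ _ e20') := dl.
  rewrite /dnbhs near_withinE => /nbhs_ballP[r /= r0 H'].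
  pose h : R := Num.min (rho / 2) (r / 2).
  have h0 : 0 < h by rewrite lt_min !divr_gt0.
  have hrho : h < rho by rewrite gt_min; apply/orP; left; lra.
  have hr : h < r by rewrite gt_min; apply/orP; right; lra.
  have := H' h; rewrite /ball /= sub0r normrN gtr0_norm// => /(_ hr).
  rewrite gt_eqF// => /(_ isT); rewrite normr_leE fmorphV.
  have := H h%:C; rewrite normc_real gtr0_norm// => /(_ _ hrho).
  rewrite (_ : h%:C != 0); last by rewrite -normc_gt0 normc_real normr_gt0 gt_eqF.
  move=> /(_ isT); set q := _ * _; rewrite (normc_distC q) => h1 h2.
  by have := normc_dist_trans d q l; rewrite (normc_distC q); lra.
move=> e /Hd[rho rho0 H]; exists rho => // h hr.
have [->|h0] := eqVneq h 0.
  by rewrite scale0r addr0 subrr mulr0 subrr normc0 mulr0.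
have := H h h0 hr; rewrite ld.
rewrite -(ler_pM2r (_ : 0 < normc h)) ?normc_gt0// -normcM.
by rewrite mulrBl mulrAC mulVf// mul1r.
Qed.

Lemma subst_coord_id z j : subst_coord z j (z 0 j) = z.
Proof. by apply/rowP => k; rewrite mxE; case: eqP => // ->. Qed.

Lemma subst_coordD z j (w h : R[i]) :
  subst_coord z j (w + h) = subst_coord z j w + h *: delta_mx 0 j.
Proof.
apply/rowP => k; rewrite !mxE eqxx /=.
by case: (k == j); rewrite ?mulr1// mulr0 addr0.
Qed.

Lemma segment_lt (a b q : R[i]) (t r : R) : 0 <= t <= 1 ->
  normc (a - q) < r -> normc (b - q) < r -> normc (a + t%:C * (b - a) - q) < r.
Proof.
move=> /andP[t0 t1] ar br.
have -> : a + t%:C * (b - a) - q = (1 - t)%:C * (a - q) + t%:C * (b - q).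
  by rewrite rmorphB /=; ring.
rewrite (le_lt_trans (normcD _ _))// !normcM !normc_real !ger0_norm ?subr_ge0//.
have [->|tn0] := eqVneq t 0; first by rewrite mul0r addr0 subr0 mul1r.
have t0' : 0 < t by rewrite lt_neqAle eq_sym tn0.
have := ler_wpM2l (_ : 0 <= 1 - t) (ltW ar); rewrite subr_ge0 => /(_ t1).
by have := br; rewrite -(ltr_pM2l t0'); lra.
Qed.

Lemma open_partial_le f g z j (w A : R[i]) (eps : R) :
  holomorphic_on (@polydisc R n) f ->
  (forall z, polydisc z -> is_real_derive f z (1 *: delta_mx 0 j) (g z)) ->
  polydisc z -> polydisc (subst_coord z j w) ->
  (forall t : R, 0 <= t <= 1 ->
     normc (g (subst_coord z j (z 0 j + t%:C * (w - z 0 j))) - A) <= eps) ->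
  normc (f (subst_coord z j w) - f z - A * (w - z 0 j)) <= eps * normc (w - z 0 j).
Proof.
move=> hf dg zD wD gA.
have := complex_mean_value_le (fun u => f (subst_coord z j u)) (z 0 j) w A eps.
rewrite subst_coord_id; apply => t t01; set x := z 0 j + _.
exists (g (subst_coord z j x)); first exact: gA.
have xD : polydisc (subst_coord z j x).
  have /polydiscP zk := zD.
  apply/polydiscP => k; rewrite mxE; case: eqP => _ //.
  rewrite -[x]subr0; apply: segment_lt => //; rewrite subr0//.
  by have /polydiscP/(_ j) := wD; rewrite mxE eqxx.
move=> e e0; have [rho rho0 H] := holomorphic_partial _ _ _ _ (hf _ xD) (dg _ xD) _ e0.
by exists rho => // h hr; rewrite subst_coordD; exact: H.
Qed.

(** Both points may lie on the boundary, so they are scaled by 1 - s into the open polydisc, where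
    the mean value inequality holds with slopes within [eps] of g(p) by continuity of [g].
    Continuity of [f] at the two points lets s tend to 0. Only [s] depends on the two points; [rho]
    depends on [p] and [eps]. *)
Lemma partial_strict_diff f p j : holomorphic_on (@polydisc R n) f ->
  C1_closed_polydisc f -> closed_polydisc p ->
  exists A : R[i], forall eps : R, 0 < eps -> exists2 rho : R, 0 < rho &
    forall z w, closed_polydisc z -> normc w <= 1 ->
      (forall k, normc (z 0 k - p 0 k) < rho) -> normc (w - p 0 j) < rho ->
      normc (f (subst_coord z j w) - f z - A * (w - z 0 j)) <=
        eps * normc (w - z 0 j).
Proof.
move=> hf [cf df] pD; have [|g [cg dg]] := df j 1; first by left.
exists (g p) => eps eps0.
have [rho rho0 Hg] := within_closed_polydisc_le _ cg _ pD _ eps0.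
exists (rho / 2); first by rewrite divr_gt0.
move=> z w zD w1 zp wp; set u := subst_coord z j w.
have uD : closed_polydisc u.
  have /closed_polydiscP zk := zD.
  by apply/closed_polydiscP => k; rewrite mxE; case: eqP.
set d := normc (w - z 0 j).
apply/ler_addgt0Pr => e e0.
(* Scaling costs e/K at each of the two values of [f] and at most (e/K) |g(p)| d in the linear term,
   in total [e]. *)
set K := normc (g p) * d + 2.
have d0 : 0 <= d := normc_ge0 _.
have K0 : 0 < K by rewrite ltr_wpDl// mulr_ge0// normc_ge0.
have e10 : 0 < e / K by rewrite divr_gt0.
have [r1 r10 H1] := within_closed_polydisc_le _ cf _ zD _ e10.
have [r2 r20 H2] := within_closed_polydisc_le _ cf _ uD _ e10.
pose s := Num.min (Num.min (1 / 2) (e / K)) (Num.min (rho / 4) (Num.min (r1 / 2) (r2 / 2))).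
have s0 : 0 < s by rewrite !lt_min !divr_gt0.
have [s2 se srho sr1 sr2] : [/\ s <= 1 / 2, s <= e / K, s <= rho / 4, s <= r1 / 2 & s <= r2 / 2].
  by have := lexx s; rewrite {2}/s !le_min => /andP[/andP[-> ->] /and3P[-> -> ->]].
pose c : R[i] := (1 - s)%:C.
have nc : normc c = 1 - s by rewrite normc_real ger0_norm; lra.
have shrink (x : R[i]) : normc x <= 1 -> normc (c * x) < 1 /\ normc (c * x - x) <= s.
  move=> x1; have -> : c * x - x = - (s%:C * x) by rewrite /c rmorphB /=; ring.
  rewrite normcN !normcM nc normc_real (gtr0_norm s0).
  split; first by rewrite (@le_lt_trans _ _ ((1 - s) * 1)) ?ler_wpM2l//; lra.
  by rewrite ler_piMr// ltW.
have shrinkD (x : 'rV[R[i]]_n) : closed_polydisc x -> polydisc (c *: x).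
  move=> /closed_polydiscP xD; apply/polydiscP => k; rewrite mxE.
  by case: (shrink _ (xD k)).
have shrinkN (x : 'rV[R[i]]_n) : closed_polydisc x -> forall k, normc ((c *: x) 0 k - x 0 k) <= s.
  move=> /closed_polydiscP xD k; rewrite mxE.
  by case: (shrink _ (xD k)).
have polydiscW (x : 'rV[R[i]]_n) : polydisc x -> closed_polydisc x.
  by move=> /polydiscP xD; apply/closed_polydiscP => k; exact: ltW.
have fz : normc (f (c *: z) - f z) <= e / K.
  apply: H1 => [|k]; first exact/polydiscW/shrinkD.
  by rewrite (le_lt_trans (shrinkN _ zD k))//; lra.
have fu : normc (f (c *: u) - f u) <= e / K.
  apply: H2 => [|k]; first exact/polydiscW/shrinkD.
  by rewrite (le_lt_trans (shrinkN _ uD k))//; lra.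
have cu : c *: u = subst_coord (c *: z) j (c * w).
  by apply/rowP => k; rewrite !mxE; case: (k == j).
have := open_partial_le f g (c *: z) j (c * w) (g p) eps hf dg (shrinkD _ zD).
rewrite -cu => /(_ (shrinkD _ uD)).
have czp k : normc ((c *: z) 0 k - p 0 k) < rho.
  have := normc_dist_trans ((c *: z) 0 k) (z 0 k) (p 0 k).
  by have := shrinkN _ zD k; have := zp k; lra.
have cwp : normc (c * w - p 0 j) < rho.
  have := normc_dist_trans (c * w) w (p 0 j).
  by case: (shrink _ w1) => _; lra.
have -> : c * w - (c *: z) 0 j = c * (w - z 0 j) by rewrite mxE; ring.
rewrite normcM nc -/d.
have segD (t : R) : 0 <= t <= 1 ->
    normc (g (subst_coord (c *: z) j ((c *: z) 0 j + t%:C * (c * (w - z 0 j)))) - g p) <= eps.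
  move=> t01; have -> : c * (w - z 0 j) = c * w - (c *: z) 0 j by rewrite mxE; ring.
  apply: Hg => [|k].
    apply/closed_polydiscP => k; rewrite [subst_coord _ _ _ _ _]mxE.
    have /polydiscP czD := shrinkD _ zD.
    case: eqP => _; last exact: ltW.
    rewrite -[_ + _]subr0 ltW// segment_lt// subr0//.
    by case: (shrink _ w1).
  by rewrite [subst_coord _ _ _ _ _]mxE; case: eqP => [->|_]; [exact: segment_lt|].
move=> /(_ segD) main.
have := normc_dist_trans (f u - f z - g p * (w - z 0 j))
  (f (c *: u) - f (c *: z) - g p * (c * (w - z 0 j))) 0; rewrite !subr0.
have -> : f u - f z - g p * (w - z 0 j) -
    (f (c *: u) - f (c *: z) - g p * (c * (w - z 0 j))) =
    - (f (c *: u) - f u) + (f (c *: z) - f z) - s%:C * (g p * (w - z 0 j)).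
  by rewrite /c rmorphB /=; ring.
move=> /le_trans; apply.
have : normc (- (f (c *: u) - f u) + (f (c *: z) - f z) -
    s%:C * (g p * (w - z 0 j))) <= e.
  rewrite (le_trans (normcB _ _))//.
  have := normcD (- (f (c *: u) - f u)) (f (c *: z) - f z); rewrite normcN.
  rewrite !normcM normc_real (gtr0_norm s0) -/d.
  have : s * (normc (g p) * d) <= e / K * (normc (g p) * d).
    by rewrite ler_wpM2r// mulr_ge0// normc_ge0.
  have : e / K * K = e by rewrite divfK// gt_eqF.
  rewrite {2}/K; lra.
have : eps * ((1 - s) * d) <= eps * d.
  by rewrite ler_wpM2l ?(ltW eps0)// ler_piMl//; lra.
lra.
Qed.

End PartialStrictDiff.

(** * Growth of f near the boundary point *)

Section BoundaryRate.
Context {R : realType} {n : nat}.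
Implicit Types (f : 'rV[R[i]]_n -> R[i]) (z p : 'rV[R[i]]_n) (j k : 'I_n).

Lemma subst_coord_subst z j (w w' : R[i]) :
  subst_coord (subst_coord z j w) j w' = subst_coord z j w'.
Proof. by apply/rowP => k; rewrite !mxE; case: (k == j). Qed.

Lemma closed_polydisc_subst z j (w : R[i]) : closed_polydisc z -> normc w <= 1 ->
  closed_polydisc (subst_coord z j w).
Proof.
move=> /closed_polydiscP zD w1; apply/closed_polydiscP => k.
by rewrite mxE; case: eqP.
Qed.

Lemma slice_strict_diff f z j : holomorphic_on (@polydisc R n) f ->
  C1_closed_polydisc f -> closed_polydisc z ->
  forall x, normc x <= 1 ->
    strict_diff [set w | normc w <= 1] (fun w => f (subst_coord z j w)) x.
Proof.
move=> hf cf zD x x1.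
have [A HA] := partial_strict_diff _ _ j hf cf (closed_polydisc_subst _ j _ zD x1).
exists A => eps /HA[rho rho0 H]; exists rho => // w w' w1 w1' wx wx'.
have := H (subst_coord z j w) w'; rewrite subst_coord_subst !mxE eqxx; apply => //.
  exact: closed_polydisc_subst.
by move=> k; rewrite !mxE; case: eqP => // _; rewrite subrr normc0.
Qed.

Lemma closed_polydisc_le1 f : C1_closed_polydisc f ->
  (forall z, polydisc z -> normc (f z) <= 1) ->
  forall z, closed_polydisc z -> normc (f z) <= 1.
Proof.
move=> [cf _] f1 z zD; apply/ler_addgt0Pr => e e0.
have [r r0 H] := within_closed_polydisc_le _ cf _ zD _ e0.
pose s := Num.min (1 / 2) (r / 2).
have s0 : 0 < s by rewrite lt_min !divr_gt0.
have s2 : s <= 1 / 2 by rewrite ge_min lexx.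
have sr : s < r by rewrite gt_min; apply/orP; right; lra.
have /closed_polydiscP zk := zD.
have cD k : normc (((1 - s)%:C *: z) 0 k) <= 1 - s.
  rewrite mxE normcM normc_real ger0_norm; last lra.
  by rewrite ler_piMr//; lra.
have := f1 ((1 - s)%:C *: z); rewrite polydiscP => fc.
have := ler_normc_dist (f z) (f ((1 - s)%:C *: z)); rewrite normc_distC.
have : normc (f ((1 - s)%:C *: z) - f z) <= e.
  apply: H => [|k].
    by apply/closed_polydiscP => k; have := cD k; lra.
  rewrite (_ : _ - _ = - (s%:C * z 0 k)); last by rewrite mxE rmorphB /=; ring.
  rewrite normcN normcM normc_real gtr0_norm// (le_lt_trans _ sr)//.
  by rewrite ler_piMr// ltW.
have := fc ltac:(move=> k; have := cD k; lra); lra.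
Qed.

Lemma boundary_rate f (zeta : 'rV[R[i]]_n) (eta : R[i]) j :
  (forall z, polydisc z -> normc (f z) <= 1) ->
  holomorphic_on (@polydisc R n) f -> C1_closed_polydisc f ->
  torus zeta -> normc eta = 1 -> f zeta = eta ->
  ~ (exists c : R[i], forall w : R[i], normc w <= 1 ->
       f (subst_coord zeta j w) = c) ->
  exists2 a : R, 0 < a & forall z, closed_polydisc z ->
    (forall k, normc (z 0 k - zeta 0 k) < a) ->
    a * (1 - normc (z 0 j)) <= normc (f z - eta) /\
    forall w, normc w <= 1 -> normc (w - zeta 0 j) < a ->
      a * normc (w - z 0 j) <= normc (f (subst_coord z j w) - f z).
Proof.
move=> f1 hf cf zT e1 fz fcst.
have zN k : normc (zeta 0 k) = 1.
  have zk := zT k; have : `|zeta 0 k| <= 1%:C by rewrite zk.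
  rewrite normr_leE => le1; apply/eqP; rewrite eq_le le1 leNgt -normr_ltE.
  by rewrite zk ltxx.
have zD : closed_polydisc zeta by apply/closed_polydiscP => k; rewrite zN.
have F1 := closed_polydisc_le1 f cf f1.
have [A HA] := partial_strict_diff f zeta j hf cf zD.
have a0 : 0 < complex.Re (eta^* * (A * zeta 0 j)).
  apply: (hopf_derivative (fun w => f (subst_coord zeta j w))) => //.
  - exact: slice_strict_diff.
  - by move=> w w1; apply/F1/closed_polydisc_subst.
  - by rewrite subst_coord_id.
  - move=> eps /HA[rho rho0 H]; exists rho => // w w1 wz.
    rewrite subst_coord_id; apply: H => // k.
    by rewrite subrr normc0.
set alpha := complex.Re _ in a0.
have alphaA : alpha <= normc A.
  by rewrite (le_trans (Re_le_normc _))// !normcM normc_conj e1 zN mulr1 mul1r.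
have a20 : 0 < alpha / 2 by rewrite divr_gt0.
have [rho rho0 H] := HA _ a20.
(* An error rate alpha/2 leaves a rate alpha/2 in both conclusions, since |A| >= alpha. The radius
   is halved because the outward move below may double the distance to [zeta 0 j]. *)
exists (Num.min (alpha / 2) (rho / 2)); first by rewrite lt_min a20 divr_gt0.
set a := Num.min _ _.
have aalpha : a <= alpha / 2 by rewrite ge_min lexx.
have arho : a <= rho / 2 by rewrite ge_min lexx orbT.
move=> z zc znear; have /closed_polydiscP zk := zc.
have near k : normc (z 0 k - zeta 0 k) < rho by have := znear k; lra.
split; last first.
  move=> w w1 wz; have := H z w zc w1 near; have := normc_ge0 (w - z 0 j).
  move=> d0 /(_ ltac:(lra)) h.
  have := ler_normc_dist (A * (w - z 0 j)) (f (subst_coord z j w) - f z).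
  rewrite normcM (normc_distC (A * _)).
  have := ler_wpM2r d0 alphaA; have := ler_wpM2r d0 aalpha; lra.
set s := 1 - normc (z 0 j).
have s0 : 0 <= s by rewrite subr_ge0.
(* The move is along [zeta 0 j] rather than along [z 0 j], so that the first-order gain is exactly s
   alpha; its length s = 1 - |z_j| keeps [w] in the closed disc. *)
pose w := z 0 j + s%:C * zeta 0 j.
have ns : normc (s%:C * zeta 0 j) = s.
  by rewrite normcM normc_real zN mulr1 ger0_norm.
have w1 : normc w <= 1.
  by rewrite (le_trans (normcD _ _))// ns /s; lra.
have wz : normc (w - zeta 0 j) < rho.
  rewrite /w addrAC (le_lt_trans (normcD _ _))// ns.
  have := znear j; have := ler_normc_dist (zeta 0 j) (z 0 j).
  rewrite zN normc_distC -/s; lra.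
have := H z w zc w1 near wz.
have -> : w - z 0 j = s%:C * zeta 0 j by rewrite /w; ring.
rewrite ns; set E := _ - _ - _ => HE.
have := F1 _ (closed_polydisc_subst z j w zc w1).
have -> : normc (f (subst_coord z j w)) = normc (eta^* * f (subst_coord z j w)).
  by rewrite normcM normc_conj e1 mul1r.
have -> : eta^* * f (subst_coord z j w) =
    1 + eta^* * (f z - eta) + eta^* * E + s%:C * (eta^* * (A * zeta 0 j)).
  have -> : 1 = eta^* * eta by rewrite conjc_mul e1 expr1n.
  by rewrite /E; ring.
move=> /(le_trans (Re_le_normc _)); rewrite Re_affine -/alpha.
have Re_lower (x : R[i]) : - normc x <= complex.Re x.
  by rewrite lerNl -normcN (le_trans _ (Re_le_normc (- x)))//; case: (x).
have := Re_lower (eta^* * (f z - eta)); have := Re_lower (eta^* * E).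
rewrite !normcM normc_conj e1 !mul1r.
have ReD (x y : R[i]) : complex.Re (x + y) = complex.Re x + complex.Re y.
  by case: x y => [? ?] [? ?].
rewrite !ReD; have := ler_wpM2r s0 aalpha; rewrite /=; lra.
Qed.

End BoundaryRate.

(** * Volume estimates *)

Section PowerMeasure.
Local Open Scope ereal_scope.
Context {R : realType}.

(* [ge0_le_integral] without measurability: the integral of a nonnegative function
   is a supremum over the simple functions below it. *)
Lemma ge0_le_integralT d (T : measurableType d) (mu : {measure set T -> \bar R})
    (f g : T -> \bar R) : (forall x, 0 <= f x) -> (forall x, f x <= g x) ->
  \int[mu]_x f x <= \int[mu]_x g x.
Proof.
move=> f0 fg; have g0 x : 0 <= g x := le_trans (f0 x) (fg x).
rewrite !ge0_integralTE//; apply: le_ereal_sup => _ [h hf <-].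
exists h => // x.
exact: le_trans (hf x) (fg x).
Qed.

Context d (T : measurableType d) (mu : {measure set T -> \bar R}).

Lemma power_measure_ge0 n (A : set (n.-tuple T)) : 0 <= power_measure mu A.
Proof.
elim: n A => [|n ih] A /=; first by rewrite diracE lee_fin.
by apply: integral_ge0 => x _; exact: ih.
Qed.

Lemma power_measureS n (A : set (n.+1.-tuple T)) : power_measure mu A =
  \int[mu]_x power_measure mu [set t : n.-tuple T | A [tuple of x :: t]].
Proof.
apply: eq_integral => x _ /=; congr (power_measure mu _).
by apply/seteqP; split => t; rewrite /xsection /= inE.
Qed.

Lemma power_measure0 n : power_measure mu (set0 : set (n.-tuple T)) = 0.
Proof.
elim: n => [|n ih]; first by rewrite /= diracE in_set0.
rewrite power_measureS; under eq_integral do rewrite -/set0 ih.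
exact: integral0.
Qed.

(** Here [f] will be the measure of the slices of an arbitrary set, so measurability is asked of [S]
    alone. *)
Lemma integral_cst_indic_le (f : T -> \bar R) (S : set T) (c : R) (m : R) :
  (0 <= c)%R -> measurable S -> mu S <= m%:E -> (forall x, 0 <= f x) ->
  (forall x, S x -> f x <= c%:E) -> (forall x, ~ S x -> f x = 0) ->
  \int[mu]_x f x <= (c * m)%:E.
Proof.
move=> c0 mS Sm f0 fc fz.
apply: (@le_trans _ _ (\int[mu]_x (c%:E * (\1_S x)%:E))).
  apply: ge0_le_integralT => // x; rewrite indicE.
  have [/set_mem xS|/negP xS] := boolP (x \in S); first by rewrite mule1 fc.
  by rewrite mule0 fz// => /mem_set.
rewrite ge0_integralZl_EFin//; last first.
  by apply/measurable_EFinP; exact: measurable_indic.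
by rewrite integral_indic// setIT EFinM lee_wpmul2l// lee_fin.
Qed.

(** Induction peels off the first coordinate, which is confined to [S]; the slices inherit the
    hypotheses, until a single coordinate is left, confined to [B]. Anchoring [B] at a point of [A]
    means that only nonempty fibres have to be covered. *)
Lemma power_measure_le n (S : set T) (m c : R) (A : set (n.+1.-tuple T)) :
  (0 <= m)%R -> (0 <= c)%R -> measurable S -> mu S <= m%:E ->
  (forall t, A t -> forall i : 'I_n.+1, (i < n)%N -> S (tnth t i)) ->
  (forall t, A t -> exists B, [/\ measurable B, mu B <= c%:E &
     forall t', A t' -> (forall i : 'I_n.+1, (i < n)%N -> tnth t' i = tnth t i) ->
       B (tnth t' ord_max)]) ->
  power_measure mu A <= (m ^+ n * c)%:E.
Proof.
move=> m0 c0 mS Sm; elim: n A => [|n ih] A AS AB.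
  have [->|/set0P[t At]] := eqVneq A set0.
    by rewrite power_measure0 lee_fin expr0 mul1r.
  have [B [mB Bc HB]] := AB t At.
  rewrite power_measureS expr0.
  have inB x u : A [tuple of x :: (u : 0.-tuple T)] -> B x.
    move=> Ax; have := HB _ Ax; rewrite (tnth_nth x) /=; apply.
    by move=> i; rewrite ltn0.
  apply: integral_cst_indic_le mB Bc _ _ _ => // x.
  - by move=> _ /=; rewrite diracE lee_fin lern1 leq_b1.
  - move=> Bx; rewrite (_ : [set t | _] = set0) ?power_measure0//.
    by apply/seteqP; split => // u /inB.
rewrite power_measureS exprSr mulrAC.
apply: integral_cst_indic_le mS Sm _ _ _ => //.
- by rewrite mulr_ge0 ?exprn_ge0.
- by move=> x; exact: power_measure_ge0.
- move=> x _; apply: ih => [t At i iN|t At].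
    have := AS _ At (lift ord0 i); rewrite tnthS; apply.
    by rewrite lift0.
  have [B [mB Bc HB]] := AB _ At; exists B; split => // t' At' tt'.
  have := HB _ At'; rewrite (_ : ord_max = lift ord0 ord_max); last exact/val_inj.
  rewrite tnthS; apply => i iN.
  case: (unliftP ord0 i) iN => [k ->|->] iN; last by rewrite !tnth0.
  by rewrite !tnthS; apply: tt'; rewrite lift0 in iN.
- move=> x Sx; rewrite (_ : [set t | _] = set0) ?power_measure0//.
  apply/seteqP; split => // t At; apply: Sx.
  by have := AS _ At ord0; rewrite tnth0; exact.
Qed.

End PowerMeasure.

(** * Planar area of squares and thin annuli *)

Section PlaneMeasure.
Local Open Scope ereal_scope.
Context {R : realType}.
Local Notation lambda := (@lebesgue_measure R).
Local Notation realR := (measurableTypeR R).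

Lemma lebesgue_measure_ball (x d : R) : (0 <= d)%R ->
  lambda `[(x - d)%R, (x + d)%R] = (2 * d)%:E.
Proof.
move=> d0; rewrite lebesgue_measure_itv /= lte_fin.
case: ltP => h; first by rewrite -EFinB; congr EFin; ring.
by congr EFin; lra.
Qed.

Lemma lebesgue_plane_square (x y d : R) : (0 <= d)%R ->
  lebesgue_plane (`[(x - d)%R, (x + d)%R] `*` `[(y - d)%R, (y + d)%R]) =
  (4 * d ^+ 2)%:E :> \bar R.
Proof.
move=> d0; rewrite /lebesgue_plane product_measure1E//.
rewrite [X in X * _](lebesgue_measure_ball x _ d0).
by rewrite [X in _ * X](lebesgue_measure_ball y _ d0) -EFinM; congr EFin; ring.
Qed.

(** Factor y^2 - y0^2 = (y - y0)(y + y0). Since both moduli are at least 1/2, one factor has modulus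
    at least 1, so the other is at most [s]: y lies within [s] of y0 or of -y0. *)
Lemma lebesgue_measure_sqr_le (Y : set realR) (s : R) : measurable Y ->
  (0 < s)%R -> (forall y : R, Y y -> 1 / 2 <= `|y|)%R ->
  (forall y y' : R, Y y -> Y y' -> `|y ^+ 2 - y' ^+ 2| <= s)%R ->
  lambda Y <= (4 * s)%:E.
Proof.
move=> mY s0 Y2 Ys.
have [->|/set0P[y0 Yy0]] := eqVneq Y set0.
  by rewrite measure0 lee_fin; lra.
apply: (@le_trans _ _
  (lambda (`[(y0 - s)%R, (y0 + s)%R] `|` `[(- y0 - s)%R, (- y0 + s)%R]))).
  apply: le_measure; rewrite ?inE//; first exact: measurableU.
  move=> y Yy; have := Ys _ _ Yy Yy0; have := Y2 _ Yy; have := Y2 _ Yy0.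
  rewrite /= !in_itv /= ler_norml => h0 h /andP[l u].
  have [y0p|y0n] := leP 0%R y0; have [yp|yn] := leP 0%R y;
    move: h0 h; rewrite ?(ger0_norm y0p) ?(ltr0_norm y0n)
      ?(ger0_norm yp) ?(ltr0_norm yn) => h0 h;
    [left|right|right|left]; apply/andP; split; nra.
rewrite (le_trans (measureU2 _ _ _))//.
rewrite [X in X + _](lebesgue_measure_ball _ _ (ltW s0)).
rewrite [X in _ + X](lebesgue_measure_ball _ _ (ltW s0)).
by rewrite -EFinD lee_fin; lra.
Qed.

Lemma sqrD_le1_coord (u v : R) : (u ^+ 2 + v ^+ 2 <= 1)%R ->
  (`[(0 - 1)%R, (0 + 1)%R]%classic : set R) u.
Proof.
move=> uv; rewrite /= in_itv /= sub0r add0r -ler_norml.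
rewrite -(@ler_pXn2r _ 2) ?nnegrE// expr1n real_normK ?num_real//.
by have := sqr_ge0 v; lra.
Qed.

Definition annular_strip (s : R) : set (realR * realR) :=
  [set p | (1 - s <= p.1 ^+ 2 + p.2 ^+ 2 <= 1)%R].

Lemma annular_stripE s (x y : R) :
  annular_strip s (x, y) = (1 - s <= x ^+ 2 + y ^+ 2 <= 1)%R.
Proof. by []. Qed.

Lemma annular_strip_sqr_dist s (x y y' : R) : annular_strip s (x, y) ->
  annular_strip s (x, y') -> (`|y ^+ 2 - y' ^+ 2| <= s)%R.
Proof.
rewrite !annular_stripE => /andP[a b] /andP[a' b'].
by rewrite ler_norml; apply/andP; split; lra.
Qed.

Lemma annular_stripC s (x y : R) : annular_strip s (x, y) = annular_strip s (y, x).
Proof. by rewrite !annular_stripE [(x ^+ 2 + _)%R]addrC. Qed.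

Lemma annular_strip_coord s (x y : R) : annular_strip s (x, y) ->
  (`[(0 - 1)%R, (0 + 1)%R]%classic : set R) x.
Proof. by rewrite annular_stripE => /andP[_]; exact: sqrD_le1_coord. Qed.

Lemma measurable_annular_strip s : measurable (annular_strip s).
Proof.
have mr : measurable_fun [set: realR * realR]
    (fun p => (p.1 ^+ 2 + p.2 ^+ 2)%R : R).
  by apply: measurable_funD; apply: measurable_funX.
have := mr measurableT _ (measurable_itv `[(1 - s)%R, 1%R]).
by rewrite setTI; congr measurable; apply/seteqP; split => p /=; rewrite in_itv.
Qed.

Lemma measurable_normr_ge (h : realR * realR -> R) :
  measurable_fun setT h -> measurable [set p | (1 / 2 <= `|h p|)%R].
Proof.
move=> mh; have mn : measurable_fun setT (fun p => `|h p|%R : R).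
  by apply: measurableT_comp.
have := mn measurableT _ (measurable_itv `[(1 / 2)%R, +oo[).
rewrite setTI; congr measurable.
by apply/seteqP; split => p /=; rewrite in_itv /= andbT.
Qed.

(** For s < 1/2 each point has a coordinate of modulus at least 1/2. Slicing across that coordinate
    gives 4 s per slice over an interval of length 2, hence 8 s for each of the two pieces. For
    larger [s] the enclosing square of area 4 is enough. *)
Lemma annular_strip_le (s : R) : (0 < s)%R ->
  lebesgue_plane (annular_strip s) <= (16 * s)%:E.
Proof.
move=> s0.
have [s2|s2] := leP (1 / 2)%R s.
  apply: (@le_trans _ _ (lebesgue_plane
    (`[(0 - 1)%R, (0 + 1)%R] `*` `[(0 - 1)%R, (0 + 1)%R]))).
    apply: le_measure; rewrite ?inE.
    - exact: measurable_annular_strip.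
    - exact: measurableX.
    - move=> [x y] xy; split; first exact: annular_strip_coord xy.
      by rewrite annular_stripC in xy; exact: annular_strip_coord xy.
  by rewrite lebesgue_plane_square// lee_fin; lra.
pose T1 := annular_strip s `&` [set p | (1 / 2 <= `|p.2|)%R].
pose T2 := annular_strip s `&` [set p | (1 / 2 <= `|p.1|)%R].
have mT1 : measurable T1.
  by apply: measurableI; [exact: measurable_annular_strip|exact: measurable_normr_ge].
have mT2 : measurable T2.
  by apply: measurableI; [exact: measurable_annular_strip|exact: measurable_normr_ge].
have l2 : lambda `[(0 - 1)%R, (0 + 1)%R] <= 2%:E.
  by rewrite lebesgue_measure_ball// mulr1.
have m1 : lebesgue_plane T1 <= (4 * s * 2)%:E.
  rewrite /lebesgue_plane /product_measure1.
  apply: (integral_cst_indic_le _ _ lambda _ _ _ _ _ (measurable_itv _) l2) => //.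
  - by rewrite mulr_ge0// ltW.
  - move=> x _ /=; apply: lebesgue_measure_sqr_le => //.
    + exact: measurable_xsection.
    + by move=> y; rewrite /xsection /= inE => -[].
    + move=> y y'; rewrite /xsection /= !inE => -[h _] [h' _].
      exact: annular_strip_sqr_dist h h'.
  - move=> x xN /=; rewrite (_ : xsection T1 x = set0) ?measure0//.
    apply/seteqP; split => // y; rewrite /xsection /= inE => -[h _].
    exact/xN/(annular_strip_coord _ _ _ h).
have m2 : lebesgue_plane T2 <= (4 * s * 2)%:E.
  (* Tonelli: the second piece is sliced horizontally, in the other order of integration. *)
  have -> : lebesgue_plane T2 = (lambda \x^ lambda) T2.
    by apply: product_measure_unique => // A B mA mB; exact: product_measure2E.
  rewrite /= /product_measure2.
  apply: (integral_cst_indic_le _ _ lambda _ _ _ _ _ (measurable_itv _) l2) => //.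
  - by rewrite mulr_ge0// ltW.
  - move=> y _ /=; apply: lebesgue_measure_sqr_le => //.
    + exact: measurable_ysection.
    + by move=> x; rewrite /ysection /= inE => -[].
    + move=> x x'; rewrite /ysection /= !inE => -[h _] [h' _].
      by apply: (annular_strip_sqr_dist s y); rewrite annular_stripC.
  - move=> y yN /=; rewrite (_ : ysection T2 y = set0) ?measure0//.
    apply/seteqP; split => // x; rewrite /ysection /= inE => -[h _].
    by apply: yN; apply: (annular_strip_coord s y x); rewrite annular_stripC.
apply: (@le_trans _ _ (lebesgue_plane (T1 `|` T2))).
  apply: le_measure; rewrite ?inE.
  - exact: measurable_annular_strip.
  - exact: measurableU.
  - move=> [x y] xy; have := xy; rewrite annular_stripE => /andP[h _].
    have [y2|y2] := leP (1 / 2)%R `|y|%R; [by left|right; split => //=].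
    rewrite leNgt; apply/negP => x2.
    have := normr_ge0 x; have := normr_ge0 y.
    by move: h; rewrite -(real_normK (num_real x)) -(real_normK (num_real y)); nra.
rewrite (le_trans (measureU2 _ _ _))//.
by rewrite (le_trans (leeD m1 m2))// -EFinD lee_fin; lra.
Qed.

End PlaneMeasure.

(** The 2 bounds the factor 1 + r in 1 - r^2 = (1 - r)(1 + r). *)
Lemma annular_strip_normc {R : realType} (x y e : R) : normc (x +i* y) <= 1 ->
  1 - normc (x +i* y) <= e -> annular_strip (2 * e) (x, y).
Proof.
move=> n1 ne; rewrite annular_stripE.
have <- : normc (x +i* y) ^+ 2 = x ^+ 2 + y ^+ 2 by rewrite sqr_normc2.
by have := normc_ge0 (x +i* y); move: (normc _) n1 ne => r n1 ne r0; nra.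
Qed.

Lemma exists_pos_lower_bound {R : realType} n (a : 'I_n -> R) :
  (forall j, 0 < a j) -> exists2 b : R, 0 < b & forall j, b <= a j.
Proof.
move=> a0; exists (\big[Num.min/1]_j a j).
  by elim/big_ind : _ => // x y x0 y0; rewrite lt_min x0.
by move=> j; rewrite (bigD1 j)//= ge_min lexx.
Qed.

Theorem lemma1 (R : realType) (n : nat) (f : 'rV[R[i]]_n -> R[i])
    (zeta : 'rV[R[i]]_n) (eta : R[i]) :
  (forall z, polydisc z -> `|f z| < 1) ->
  holomorphic_on (@polydisc R n) f ->
  C1_closed_polydisc f ->
  torus zeta ->
  `|eta| = 1 ->
  f zeta = eta ->
  (forall j : 'I_n, ~ exists c : R[i], forall w : R[i], `|w| <= 1 ->
     f (subst_coord zeta j w) = c) ->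
  exists (U : set 'rV[R[i]]_n) (C : R),
    [/\ open_nbhs zeta U, 0 < C &
      forall delta : R, 0 < delta ->
        (vol [set z | [/\ polydisc z, U z & (`|f z - eta| <= delta%:C)%R]]
         <= (C * delta ^+ n.+1)%R%:E)%E].
Proof.
case: n f zeta => [|n] f zeta f1 hf cf zT e1 fz fcst.
  (* With no variables the only point lies in the open polydisc, so |f zeta| < 1 contradicts |eta| =
     1. *)
  have /f1 : polydisc zeta by case.
  by rewrite fz e1 ltxx.
have f1' z : polydisc z -> normc (f z) <= 1.
  by move=> /f1 fz1; rewrite ltW// -(normr_ltE _ 1).
have e1' : normc eta = 1.
  have eta1 : `|eta| <= 1%:C by rewrite e1.
  rewrite normr_leE in eta1; apply/eqP; rewrite eq_le eta1 leNgt -normr_ltE.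
  by rewrite e1 ltxx.
have /choice[a Ha] : forall j, exists a : R, 0 < a /\
    forall z, closed_polydisc z -> (forall k, normc (z 0 k - zeta 0 k) < a) ->
    a * (1 - normc (z 0 j)) <= normc (f z - eta) /\
    forall w, normc w <= 1 -> normc (w - zeta 0 j) < a ->
      a * normc (w - z 0 j) <= normc (f (subst_coord z j w) - f z).
  move=> j; have [//|a a0 Ha] := boundary_rate f zeta eta j f1' hf cf zT e1' fz.
    move=> [c Hc]; apply: (fcst j); exists c => w w1; apply: Hc.
    by rewrite -(normr_leE _ 1).
  by exists a.
have [b b0 ba] := exists_pos_lower_bound (n.+1) a (fun j => (Ha j).1).
(* Each of the first [n] coordinates lies in a strip of parameter 2 delta / b, of area at most 32
   delta / b; the last one lies in a square of half-side 2 delta / b, of area 16 delta^2 / b^2. *)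
pose C : R := (pi ^+ n.+1)^-1 * ((32 / b) ^+ n * (16 / b ^+ 2)).
have piX : 0 < (pi ^+ n.+1)^-1 :> R by rewrite invr_gt0 exprn_gt0// pi_gt0.
exists (ball zeta b%:C)^°, C; split.
- split; first exact: open_interior.
  by apply: nbhsx_ballx; rewrite ltcR.
- by rewrite mulr_gt0// mulr_gt0 ?exprn_gt0 ?divr_gt0 ?exprn_gt0.
move=> delta delta0; rewrite /vol.
set A := [set t | _].
have db0 : 0 < delta / b by rewrite divr_gt0.
pose row (t : n.+1.-tuple (measurableTypeR R * measurableTypeR R)) : 'rV[R[i]]_n.+1 :=
  \row_j ((tnth t j).1 +i* (tnth t j).2).
have inA t : A t -> [/\ closed_polydisc (row t),
    forall k, normc (row t 0 k - zeta 0 k) < b & normc (f (row t) - eta) <= delta].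
  move=> [tD /interior_subset tU td]; split.
  - by apply/closed_polydiscP => k; move/polydiscP : tD => /(_ k)/ltW.
  - move=> k; rewrite normc_distC -normr_ltE.
    by case: tU => _ /(_ 0 k).
  - by rewrite -normr_leE; exact: td.
have far t j : A t -> forall k, normc (row t 0 k - zeta 0 k) < a j.
  by move=> /inA[_ H _] k; rewrite (lt_le_trans (H k)).
have : (power_measure lebesgue_plane A <=
    ((16 * (2 * (delta / b))) ^+ n * (4 * (2 * (delta / b)) ^+ 2))%:E)%E.
  apply: (power_measure_le _ _ _ _ (annular_strip (2 * (delta / b)))).
  - by rewrite mulr_ge0// mulr_ge0// ltW.
  - by rewrite mulr_ge0// sqr_ge0.
  - exact: measurable_annular_strip.
  - by apply: annular_strip_le; rewrite mulr_gt0.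
  - move=> t At i _; have [tD _ td] := inA t At.
    have [+ _] := (Ha i).2 _ tD (far t i At).
    have /closed_polydiscP/(_ i) ti := tD.
    have i0 : 0 <= 1 - normc (row t 0 i) by rewrite subr_ge0.
    move=> /(le_trans (ler_wpM2r i0 (ba i)))/le_trans/(_ td).
    rewrite mulrC -ler_pdivlMr// => h.
    move: ti h; rewrite [row t 0 i]mxE; case: (tnth t i) => x y.
    exact: annular_strip_normc.
  - move=> t At; have [tD _ td] := inA t At.
    (* Two points of [A] that differ only in the last coordinate have values of [f] within 2 delta
       of each other, so these coordinates are within 2 delta / b. *)
    pose c := tnth t ord_max; pose d := 2 * (delta / b).
    have d0 : 0 <= d by rewrite mulr_ge0// ltW.
    exists (`[c.1 - d, c.1 + d] `*` `[c.2 - d, c.2 + d]); split.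
    + exact: measurableX.
    + by rewrite le_eqVlt; apply/predU1P; left; exact: lebesgue_plane_square.
    + move=> t' At' tt'; have [tD' tz' td'] := inA t' At'.
      pose w := row t' 0 ord_max.
      have rowE : row t' = subst_coord (row t) ord_max w.
        apply/rowP => k; rewrite [RHS]mxE; case: eqP => [->//|/eqP kn].
        have kn' : (k < n)%N.
          rewrite ltn_neqAle -[(k <= n)%N]ltnS ltn_ord andbT.
          by apply: contra kn => /eqP kn; apply/eqP/val_inj.
        by rewrite !mxE tt'.
      have [_ /(_ w)] := (Ha ord_max).2 _ tD (far t ord_max At).
      have w1 : normc w <= 1 by move/closed_polydiscP : tD'; exact.
      have wz : normc (w - zeta 0 ord_max) < a ord_max by exact: far.
      move=> /(_ w1 wz); rewrite -rowE => h.
      have wd : normc (w - row t 0 ord_max) <= d.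
        have n0 := normc_ge0 (w - row t 0 ord_max).
        rewrite /d mulrA ler_pdivlMr// mulrC.
        rewrite (le_trans (ler_wpM2r n0 (ba ord_max)))// (le_trans h)//.
        have := normc_dist_trans (f (row t')) eta (f (row t)).
        by rewrite (normc_distC eta); lra.
      have := le_trans (normr_Re_le _) wd; have := le_trans (normr_Im_le _) wd.
      rewrite /w !mxE -/c; move: (tnth t' ord_max) (c) => [x' y'] [x y] /=.
      rewrite !ler_norml !in_itv /= => /andP[? ?] /andP[? ?].
      by split; apply/andP; split; lra.
move=> /(lee_wpmul2l _) => /(_ ((pi ^+ n.+1)^-1)%:E); rewrite lee_fin.
move=> /(_ (ltW piX)) /le_trans; apply.
rewrite -EFinM lee_fin le_eqVlt; apply/orP; left; apply/eqP.
have -> : 16 * (2 * (delta / b)) = 32 / b * delta by ring.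
rewrite exprMn /C -[n.+2]addn2 exprD.
move: (_^-1) (_ ^+ n) (delta ^+ n) => p u v; field.
by rewrite gt_eqF.
Qed.
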